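(* Suppose that Assumption (A) (stated in the context) holds and let $\{(x^k,z^k,y^k)\}_{k\ge0}$ be a sequence generated by Algorithm 1 or Algorithm 2, which is assumed to be bounded. Let $\omega:=\omega(\{(x^k,z^k,y^k)\}_{k\ge0})$ be its set of cluster points. Then: (i) if $\{(x^{k_q},z^{k_q},y^{k_q})\}_{q\ge0}$ is a subsequence of $\{(x^k,z^k,y^k)\}_{k\ge0}$ which converges to $(\widehat x,\widehat z,\widehat y)$ as $q\to+\infty$, then $\lim_{q\to\infty}\mathcal{L}_r(x^{k_q},z^{k_q},y^{k_q})=\mathcal{L}_r(\widehat x,\widehat z,\widehat y)$; (ii) it holds $$\omega\subseteq\mathrm{crit}(\mathcal{L}_r)\subseteq\{(\widehat x,\widehat z,\widehat y)\in\mathbb{R}^n\times\mathbb{R}^m\times\mathbb{R}^m:\ -A^*\widehat y=\nabla h(\widehat x),\ \widehat y\in\partial g(\widehat z),\ \widehat z=A\widehat x\};$$ (iii) $\lim_{k\to+\infty}\mathrm{dist}[(x^k,z^k,y^k),\omega]=0$; (iv) the set $\omega$ is nonempty, connected and compact; (v) the limit $\mathcal{F}_*=\lim_{k\to+\infty}\mathcal{L}_r(x^k,z^k,y^k)$ exists in $\mathbb{R}$, the function $\mathcal{L}_r$ takes on $\omega$ the value $\mathcal{F}_*$, and so does the objective function $g\circ A+h$ on the projection of $\omega$ onto the space $\mathbb{R}^n$ corresponding to the first component.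
   Context: Setting. All spaces $\mathbb{R}^N$ carry the Euclidean inner product $\langle\cdot,\cdot\rangle$ and norm $\|\cdot\|$; matrices carry the operator norm. $g\colon\mathbb{R}^m\to\mathbb{R}\cup\{+\infty\}$ is proper and lower semicontinuous, $h\colon\mathbb{R}^n\to\mathbb{R}$ is Fréchet differentiable with $L$-Lipschitz continuous gradient, $A\colon\mathbb{R}^n\to\mathbb{R}^m$ is linear with adjoint $A^*$; the optimization problem is $\min_{x\in\mathbb{R}^n}\{g(Ax)+h(x)\}$. For a symmetric matrix $M$ put $\|x\|_M^2:=\langle Mx,x\rangle$; $M\succcurlyeq M'$ means $\|x\|_M^2\ge\|x\|_{M'}^2$ for all $x$; $\mathrm{Id}$ is the identity matrix; $\lambda_{\min}$ denotes the smallest eigenvalue. The augmented Lagrangian is $\mathcal{L}_r(x,z,y)=g(z)+h(x)+\langle y,Ax-z\rangle+\frac r2\|Ax-z\|^2$ on $\mathbb{R}^n\times\mathbb{R}^m\times\mathbb{R}^m$. Subdifferential. For $\Psi\colon\mathbb{R}^N\to\mathbb{R}\cup\{+\infty\}$ proper lower semicontinuous and $x$ with $\Psi(x)<+\infty$, the Fréchet subdifferential is $\widehat\partial\Psi(x)=\{d:\liminf_{y\to x}\frac{\Psi(y)-\Psi(x)-\langle d,y-x\rangle}{\|y-x\|}\ge0\}$, and the limiting subdifferential $\partial\Psi(x)$ is the set of $d$ for which there are $x^k\to x$, $d^k\to d$ with $\Psi(x^k)\to\Psi(x)$ and $d^k\in\widehat\partial\Psi(x^k)$ for all $k$; both are empty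 where $\Psi=+\infty$. $\mathrm{crit}(\Psi)=\{x:0\in\partial\Psi(x)\}$. $\mathrm{dist}(x,\Omega)=\inf_{y\in\Omega}\|x-y\|$. Algorithms. Let $\{\mathbf{M}_1^k\}_{k\ge0}\subseteq\mathbb{R}^{n\times n}$, $\{\mathbf{M}_2^k\}_{k\ge0}\subseteq\mathbb{R}^{m\times m}$ be sequences of symmetric positive semidefinite matrices, $r>0$, $0<\rho<2$, and $(x^0,z^0,y^0)\in\mathbb{R}^n\times\mathbb{R}^m\times\mathbb{R}^m$. Both algorithms generate, for every $k\ge0$, $$z^{k+1}\in\arg\min_{z\in\mathbb{R}^m}\Big\{g(z)+\langle y^k,Ax^k-z\rangle+\tfrac r2\|Ax^k-z\|^2+\tfrac12\|z-z^k\|_{\mathbf{M}_2^k}^2\Big\},$$ then $x^{k+1}$, then $y^{k+1}:=y^k+\rho r(Ax^{k+1}-z^{k+1})$, where in Algorithm 1 $$x^{k+1}\in\arg\min_{x\in\mathbb{R}^n}\Big\{h(x)+\langle y^k,Ax-z^{k+1}\rangle+\tfrac r2\|Ax-z^{k+1}\|^2+\tfrac12\|x-x^k\|_{\mathbf{M}_1^k}^2\Big\},$$ and in Algorithm 2 $$x^{k+1}\in\arg\min_{x\in\mathbb{R}^n}\Big\{\langle x-x^k,\nabla h(x^k)\rangle+\langle y^k,Ax-z^{k+1}\rangle+\tfrac r2\|Ax-z^{k+1}\|^2+\tfrac12\|x-x^k\|_{\mathbf{M}_1^k}^2\Big\}.$$ Assumption (A). (i) $g$ and $h$ are bounded from below;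 (ii) $A$ is surjective, and we set $T_0:=\frac{1}{\lambda_{\min}(AA^* )\rho}$ if $0<\rho\le1$, $T_0:=\frac{\rho}{\lambda_{\min}(AA^* )(2-\rho)^2}$ if $1<\rho<2$; (iii) $\mu_1:=\sup_{k\ge0}\|\mathbf{M}_1^k\|<+\infty$ and $\mu_2:=\sup_{k\ge0}\|\mathbf{M}_2^k\|<+\infty$; (iv) $r>0$, $\rho\in(0,2)$ and $\mu_1\ge0$ are such that $r\ge4T_0L>0$ and $2\mathbf{M}_1^k+rA^*A\succcurlyeq\big(L+\frac{C_{\mathbf M}}{r}\big)\mathrm{Id}$ for all $k\ge0$, where $C_{\mathbf M}:=(6\mu_1^2+4(L+\mu_1)^2)T_0$ for Algorithm 1 and $C_{\mathbf M}:=(4\mu_1^2+6(L+\mu_1)^2)T_0$ for Algorithm 2. *)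

(* Defs.v *)
From HB Require Import structures.
From mathcomp Require Import all_boot all_order all_algebra.
From mathcomp Require Import all_classical all_reals all_analysis.

Set Implicit Arguments.
Unset Strict Implicit.
Unset Printing Implicit Defensive.

Import Order.TTheory GRing.Theory Num.Theory.
Import numFieldNormedType.Exports.

Local Open Scope classical_set_scope.
Local Open Scope ring_scope.

(* R^N is 'cV[R]_N. The norm `|_| carried by the library on 'cV[R]_N and on
   products is the sup norm, so every quantitative notion below goes through
   the Euclidean norm instead. Limits, cluster points, differentiability,
   connectedness and compactness are the library's: both norms induce the same
   topology. *)

Definition dotv (R : realType) (N : nat) (x y : 'cV[R]_N) : R :=
  \sum_i x i 0 * y i 0.

(* The inner product of R^n x R^m x R^m = R^(n + m + m). *)
Definition dot3 (R : realType) (n m : nat)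
    (p q : 'cV[R]_n * 'cV[R]_m * 'cV[R]_m) : R :=
  dotv p.1.1 q.1.1 + dotv p.1.2 q.1.2 + dotv p.2 q.2.

Definition ipnorm (R : realType) (V : Type) (ip : V -> V -> R) (x : V) : R :=
  Num.sqrt (ip x x).

Definition enorm (R : realType) (N : nat) (x : 'cV[R]_N) : R :=
  ipnorm (@dotv R N) x.

Definition enorm3 (R : realType) (n m : nat)
    (p : 'cV[R]_n * 'cV[R]_m * 'cV[R]_m) : R :=
  ipnorm (@dot3 R n m) p.

(* Valued in \bar R so that the distance to the empty set is +oo. *)
Definition dist (R : realType) (V : zmodType) (ip : V -> V -> R)
    (x : V) (Omega : set V) : \bar R :=
  ereal_inf [set (ipnorm ip (x - y))%:E | y in Omega].

Definition opnorm (R : realType) (p q : nat) (M : 'M[R]_(p, q)) : R :=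
  sup [set enorm (M *m x) | x in [set x : 'cV[R]_q | enorm x <= 1]].

Definition sqnorm_mx (R : realType) (N : nat) (M : 'M[R]_N) (x : 'cV[R]_N) : R :=
  dotv (M *m x) x.

Definition loewner_ge (R : realType) (N : nat) (M M' : 'M[R]_N) : Prop :=
  forall x : 'cV[R]_N, sqnorm_mx M' x <= sqnorm_mx M x.

Definition sym_psd (R : realType) (N : nat) (M : 'M[R]_N) : Prop :=
  M^T = M /\ loewner_ge M 0.

(* Used for symmetric M of positive size only: the set of real eigenvalues is
   then finite and nonempty, so that the infimum is a minimum. *)
Definition lambda_min (R : realType) (N : nat) (M : 'M[R]_N) : R :=
  inf [set a : R | eigenvalue M a].

Definition grad (R : realType) (N : nat) (h : 'cV[R]_N -> R) (x : 'cV[R]_N) :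
    'cV[R]_N :=
  \col_i ('d (h : 'cV[R]_N -> R^o) x (delta_mx i 0) : R).

Lemma gradP (R : realType) (N : nat) (h : 'cV[R]_N -> R) (x v : 'cV[R]_N) :
  differentiable (h : 'cV[R]_N -> R^o) x ->
  'd (h : 'cV[R]_N -> R^o) x v = dotv (grad h x) v.
Proof.
move=> dh; rewrite [in LHS](matrix_sum_delta v) linear_sum /dotv.
by apply: eq_bigr => i _; rewrite big_ord1 linearZ mxE mulrC.
Qed.

Definition argmin d (T : Type) (P : porderType d) (f : T -> P) : set T :=
  [set x | forall y, (f x <= f y)%O].

Section Subdifferential.
Variables (R : realType) (V : normedModType R) (ip : V -> V -> R).
Local Open Scope ereal_scope.

(* Only for Psi with values in R or +oo. The limit inferior is over y <> x. *)
Definition frechet_subdiff (Psi : V -> \bar R) (x : V) : set V :=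
  [set d | Psi x < +oo /\
    0 <= limf_einf
      (fun y => (Psi y - Psi x - (ip d (y - x)%R)%:E)
                * ((ipnorm ip (y - x)%R)^-1)%:E)
      (x^')].

Definition limiting_subdiff (Psi : V -> \bar R) (x : V) : set V :=
  [set d | Psi x < +oo /\
    exists xs ds : nat -> V,
      [/\ xs @ \oo --> x,
          ds @ \oo --> d,
          Psi (xs k) @[k --> \oo] --> Psi x &
          forall k, frechet_subdiff Psi (xs k) (ds k)]].

Definition crit (Psi : V -> \bar R) : set V :=
  [set x | limiting_subdiff Psi x 0%R].

End Subdifferential.

Section ProximalADMM.
Variables (R : realType) (n m : nat).
Variables (g : 'cV[R]_m -> \bar R) (h : 'cV[R]_n -> R) (A : 'M[R]_(m, n)).

Definition aug_lagrangian (r : R) (p : 'cV[R]_n * 'cV[R]_m * 'cV[R]_m) : \bar R :=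
  let: (x, z, y) := p in
  (g z + (h x + dotv y (A *m x - z) + r / 2 * enorm (A *m x - z) ^+ 2)%:E)%E.

Variant algorithm := Algorithm1 | Algorithm2.

Definition z_objective (r : R) (M2k : 'M[R]_m) (xk : 'cV[R]_n)
    (zk yk : 'cV[R]_m) (z : 'cV[R]_m) : \bar R :=
  (g z + (dotv yk (A *m xk - z) + r / 2 * enorm (A *m xk - z) ^+ 2
          + 2^-1 * sqnorm_mx M2k (z - zk))%:E)%E.

Definition x_objective (alg : algorithm) (r : R) (M1k : 'M[R]_n) (xk : 'cV[R]_n)
    (zk1 yk : 'cV[R]_m) (x : 'cV[R]_n) : R :=
  match alg with
  | Algorithm1 => h x
  | Algorithm2 => dotv (x - xk) (grad h xk)
  end
  + dotv yk (A *m x - zk1) + r / 2 * enorm (A *m x - zk1) ^+ 2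
  + 2^-1 * sqnorm_mx M1k (x - xk).

Definition generated (alg : algorithm) (M1 : nat -> 'M[R]_n) (M2 : nat -> 'M[R]_m)
    (r rho : R) (x : nat -> 'cV[R]_n) (z y : nat -> 'cV[R]_m) : Prop :=
  forall k,
    [/\ argmin (z_objective r (M2 k) (x k) (z k) (y k)) (z k.+1),
        argmin (x_objective alg r (M1 k) (x k) (z k.+1) (y k)) (x k.+1) &
        y k.+1 = y k + (rho * r) *: (A *m x k.+1 - z k.+1)].

Definition T0 (rho : R) : R :=
  if rho <= 1 then 1 / (lambda_min (A *m A^T) * rho)
  else rho / (lambda_min (A *m A^T) * (2 - rho) ^+ 2).

Definition CM (alg : algorithm) (rho L mu1 : R) : R :=
  match alg with
  | Algorithm1 => (6 * mu1 ^+ 2 + 4 * (L + mu1) ^+ 2) * T0 rho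
  | Algorithm2 => (4 * mu1 ^+ 2 + 6 * (L + mu1) ^+ 2) * T0 rho
  end.

(* mu1 and mu2 are real-valued suprema, hence the explicit has_ubound; T0 and
   CM are only meaningful for 0 < rho < 2. *)
Record assumption_A (alg : algorithm) (M1 : nat -> 'M[R]_n)
    (M2 : nat -> 'M[R]_m) (r rho L : R) : Prop := AssumptionA {
  A_g_bounded_below : exists c : R, forall z, (c%:E <= g z)%E ;
  A_h_bounded_below : exists c : R, forall x, c <= h x ;
  A_surjective : forall z : 'cV[R]_m, exists x : 'cV[R]_n, A *m x = z ;
  A_M1_bounded : has_ubound (range (fun k => opnorm (M1 k))) ;
  A_M2_bounded : has_ubound (range (fun k => opnorm (M2 k))) ;
  A_r_gt0 : 0 < r ;
  A_rho : 0 < rho < 2 ;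
  A_mu1_ge0 : 0 <= sup (range (fun k => opnorm (M1 k))) ;
  A_r_ge : 0 < 4 * T0 rho * L <= r ;
  A_M1_ge : forall k,
    let mu1 := sup (range (fun k => opnorm (M1 k))) in
    loewner_ge (2 *: M1 k + r *: (A^T *m A)) (L + CM alg rho L mu1 / r)%:M
}.

End ProximalADMM.

(* Main.v *)
Require Import Defs.
From HB Require Import structures.
From mathcomp Require Import all_boot all_order all_algebra.
From mathcomp Require Import ring lra.
From mathcomp Require Import all_classical all_reals all_analysis.

Set Implicit Arguments.
Unset Strict Implicit.
Unset Printing Implicit Defensive.

Import Order.TTheory GRing.Theory Num.Theory.
Import numFieldNormedType.Exports.

Local Open Scope classical_set_scope.
Local Open Scope ring_scope.

(** The sequence is controlled by a Lyapunov function. Write dx, dz, dy for the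
    increments of the three components and w for the vector with
    A^T y_(k+1) = (1 - rho) A^T y_k + rho w_k, which is what the optimality
    condition of the x-step becomes once the multiplier update is inserted
    ([dual_recursion]). Minimality of the z-step and the descent lemma in the
    x-step make the augmented Lagrangian decrease, except for the term
    |dy|^2 / (rho r) created by the multiplier update ([lagrangian_step]). The
    recursion for A^T y and the surjectivity of A bound that term by a
    telescoping quantity plus a multiple of |w_(k+1) - w_k|^2 ([dual_step]), and
    the increment of w is controlled by dx because the gradient of h is
    Lipschitz ([w_increment]). The Loewner bound of the assumption is just strong
    enough to absorb everything: the Lagrangian plus multiples of |A^T dy|^2 and
    |dx|^2 decreases by at least a multiple of |dx|^2 + |dy|^2
    ([lyapunov_decrease]). It is bounded below along a bounded sequence, so dx
    and dy tend to 0, hence so do dz and the residual A x - z, and the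
    Lagrangian converges to some F.

    Along a subsequence converging to (xhat, zhat, yhat) all terms of the
    Lagrangian other than g converge, hence so does g(z_k). Lower
    semicontinuity bounds g(zhat) by that limit, and comparing the minimizer of
    the z-step with zhat gives the opposite inequality ([g_limit]). Therefore
    the Lagrangian takes the value F at every cluster point.

    The optimality conditions of the steps provide Frechet subgradients of the
    Lagrangian at the iterates whose size is controlled by the increments and
    the residual ([D_frechet], [D_cvg]); they tend to 0, so cluster points are
    critical. That critical
    points solve the KKT system is a passage to the limit in the partial
    subgradients ([crit_lagrangian_sub]). The topological claims hold for every
    sequence in a compact set whose increments tend to 0.

    Frechet subgradients are handled through the equivalent condition that, for
    every e > 0, the affine minorant lowered by e |v - x| stays below the
    function near x ([frechet_subdiffP]); in that form sum and chain rules are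
    elementary. *)

(** * Euclidean inner products on normed modules *)

(** The norm of the module is only assumed equivalent to the Euclidean one: on
    column vectors and on products it is the sup norm. *)
Record euclidean (R : realType) (V : normedModType R) (ip : V -> V -> R) :
    Prop := Euclidean {
  euclideanC : forall u v, ip u v = ip v u ;
  euclideanP : forall a u v w, ip (a *: u + v) w = a * ip u w + ip v w ;
  sqr_norm_le_ip : forall u, `|u| ^+ 2 <= ip u u ;
  ip_le_sqr_norm : exists C, forall u, ip u u <= C * `|u| ^+ 2
}.

Section Euclidean.
Variables (R : realType) (V : normedModType R) (ip : V -> V -> R).
Hypothesis E : euclidean ip.
Implicit Types (u v w : V) (a : R).

Let ipC := euclideanC E.

Lemma ipDl u v w : ip (u + v) w = ip u w + ip v w.
Proof. by rewrite -[u]scale1r (euclideanP E) scale1r mul1r. Qed.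

Lemma ip0l w : ip 0 w = 0.
Proof. by apply: (addIr (ip 0 w)); rewrite -ipDl !add0r. Qed.

Lemma ipZl a u w : ip (a *: u) w = a * ip u w.
Proof. by rewrite -[a *: u]addr0 (euclideanP E) ip0l addr0. Qed.

Lemma ipNl u w : ip (- u) w = - ip u w.
Proof. by rewrite -scaleN1r ipZl mulN1r. Qed.

Lemma ipBl u v w : ip (u - v) w = ip u w - ip v w.
Proof. by rewrite ipDl ipNl. Qed.

Lemma ipDr u v w : ip w (u + v) = ip w u + ip w v.
Proof. by rewrite ipC ipDl !(ipC _ w). Qed.

Lemma ipZr a u w : ip w (a *: u) = a * ip w u.
Proof. by rewrite ipC ipZl ipC. Qed.

Lemma ipNr u w : ip w (- u) = - ip w u.
Proof. by rewrite ipC ipNl ipC. Qed.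

Lemma ipBr u v w : ip w (u - v) = ip w u - ip w v.
Proof. by rewrite ipDr ipNr. Qed.

Lemma ip0r w : ip w 0 = 0.
Proof. by rewrite ipC ip0l. Qed.

Lemma ip_ge0 u : 0 <= ip u u.
Proof. by apply: le_trans (sqr_norm_le_ip E u); rewrite exprn_ge0. Qed.

Local Notation nrm := (ipnorm ip).

Lemma ipnorm_ge0 u : 0 <= nrm u.
Proof. exact: sqrtr_ge0. Qed.

Lemma sqr_ipnorm u : nrm u ^+ 2 = ip u u.
Proof. by rewrite sqr_sqrtr ?ip_ge0. Qed.

Lemma norm_le_ipnorm u : `|u| <= nrm u.
Proof.
rewrite -(@ler_pXn2r _ 2) ?nnegrE ?ipnorm_ge0// sqr_ipnorm.
exact: sqr_norm_le_ip.
Qed.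

Lemma ipnorm_le_norm : exists2 C, 0 < C & forall u, nrm u <= C * `|u|.
Proof.
have [C CP] := ip_le_sqr_norm E.
exists (1 + `|C|) => [|u]; first by rewrite ltr_wpDr.
rewrite -(@ler_pXn2r _ 2) ?nnegrE ?ipnorm_ge0 ?mulr_ge0 ?addr_ge0//.
rewrite sqr_ipnorm (le_trans (CP u))// exprMn ler_wpM2r ?exprn_ge0//.
have := ler_norm C; have := normr_ge0 C; nra.
Qed.

Lemma ipnorm0 : nrm 0 = 0.
Proof. by rewrite /ipnorm ip0l sqrtr0. Qed.

Lemma ipnorm_eq0 u : nrm u = 0 -> u = 0.
Proof.
by move=> u0; apply/eqP; rewrite -normr_le0 (le_trans (norm_le_ipnorm u))// u0.
Qed.

Lemma ipnorm_gt0 u : u != 0 -> 0 < nrm u.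
Proof. by rewrite lt_def ipnorm_ge0 andbT; apply: contra_neq; apply: ipnorm_eq0. Qed.

Lemma ipnormZ a u : nrm (a *: u) = `|a| * nrm u.
Proof.
by rewrite /ipnorm ipZl ipZr mulrA -expr2 sqrtrM ?sqr_ge0// sqrtr_sqr.
Qed.

Lemma ipnormN u : nrm (- u) = nrm u.
Proof. by rewrite -scaleN1r ipnormZ normrN1 mul1r. Qed.

Lemma ipnormB u v : nrm (u - v) = nrm (v - u).
Proof. by rewrite -ipnormN opprB. Qed.

Lemma cauchy_schwarz u v : `|ip u v| <= nrm u * nrm v.
Proof.
have [->|/ipnorm_gt0 v0] := eqVneq v 0; first by rewrite ip0r normr0 ipnorm0 mulr0.
rewrite -(@ler_pXn2r _ 2) ?nnegrE ?mulr_ge0 ?ipnorm_ge0//.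
rewrite real_normK ?num_real// exprMn !sqr_ipnorm.
have v2 : 0 < ip v v by rewrite -sqr_ipnorm exprn_gt0.
have := ip_ge0 (ip v v *: u - ip u v *: v).
rewrite ipBl !ipBr !ipZl !ipZr (ipC v u) => H.
rewrite -subr_ge0 -(pmulr_rge0 _ v2); apply: le_trans H _.
by rewrite le_eqVlt; apply/orP; left; apply/eqP; ring.
Qed.

Lemma ip_le u v : ip u v <= nrm u * nrm v.
Proof. exact: le_trans (ler_norm _) (cauchy_schwarz u v). Qed.

Lemma ipnormD u v : nrm (u + v) <= nrm u + nrm v.
Proof.
rewrite -(@ler_pXn2r _ 2) ?nnegrE ?addr_ge0 ?ipnorm_ge0//.
rewrite sqr_ipnorm ipDl !ipDr (ipC v u) sqrrD !sqr_ipnorm.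
by have := ip_le u v; lra.
Qed.

(** The bridge between the sup-norm topology and Euclidean estimates. *)
Lemma cvg_ipnorm (T : Type) (F : set_system T) (FF : Filter F) (f : T -> V) l :
  f @ F --> l <-> nrm (f t - l) @[t --> F] --> (0 : R).
Proof.
have [C C0 CP] := ipnorm_le_norm; split => [/cvgrPdist_lt fl|fl].
  apply/cvgr0Pnorm_lt => e e0.
  have := fl (e / C) (divr_gt0 e0 C0); apply: filterS => t.
  rewrite ger0_norm ?ipnorm_ge0// ltr_pdivlMr// => ?.
  by rewrite (le_lt_trans (CP _))// -normrN opprB mulrC.
apply/cvgrPdist_lt => e e0; move/cvgr0Pnorm_lt : fl => /(_ e e0).
apply: filterS => t; rewrite ger0_norm ?ipnorm_ge0// => ?.
by rewrite -normrN opprB (le_lt_trans (norm_le_ipnorm _)).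
Qed.

Lemma near_ipnorm_lt u e : 0 < e -> \forall v \near u, nrm (v - u) < e.
Proof.
move=> e0; have /cvg_ipnorm/cvgr0Pnorm_lt/(_ e e0) : v @[v --> u] --> u by [].
by apply: filterS => t; rewrite ger0_norm ?ipnorm_ge0.
Qed.

Lemma cvg_ip (T : Type) (F : set_system T) (FF : Filter F) (f g : T -> V) (a b : V) :
  f @ F --> a -> g @ F --> b -> ip (f t) (g t) @[t --> F] --> ip a b.
Proof.
move=> /(cvg_ipnorm FF) fa /(cvg_ipnorm FF) gb.
have small : nrm (f t - a) * nrm b + nrm a * nrm (g t - b) +
    nrm (f t - a) * nrm (g t - b) @[t --> F] --> (0 : R).
  have -> : (0 : R) = 0 * nrm b + nrm a * 0 + 0 * 0 by ring.
  apply: cvgD; last exact: cvgM.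
  by apply: cvgD; apply: cvgM => //; exact: cvg_cst.
apply/cvgrPdist_le => e e0; move/cvgrPdist_le : small => /(_ _ e0).
apply: filterS => t; rewrite sub0r normrN => H.
have -> : ip a b - ip (f t) (g t) =
    - (ip (f t - a) b + ip a (g t - b) + ip (f t - a) (g t - b)).
  by rewrite !ipBl !ipBr; ring.
rewrite normrN (le_trans _ (le_trans (ler_norm _) H))//.
rewrite (le_trans (ler_normD _ _))// lerD ?cauchy_schwarz//.
by rewrite (le_trans (ler_normD _ _))// lerD ?cauchy_schwarz.
Qed.

End Euclidean.

Lemma cvg_ipnorm_le (R : realType) (V W : normedModType R) (ipV : V -> V -> R)
    (ipW : W -> W -> R) (T : Type) (F : set_system T) (FF : Filter F)
    (f : T -> V) (j : T -> W) (l : V) (l' : W) (K : R) :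
  euclidean ipV -> euclidean ipW ->
  (forall t, ipnorm ipW (j t - l') <= K * ipnorm ipV (f t - l)) ->
  f @ F --> l -> j @ F --> l'.
Proof.
move=> EV EW jf /(cvg_ipnorm EV) fl; apply/(cvg_ipnorm EW).
apply: (@squeeze_cvgr _ _ _ _ (fun=> 0) (fun t => K * ipnorm ipV (f t - l))).
- by apply: nearW => t; rewrite ipnorm_ge0 jf.
- exact: cvg_cst.
- by rewrite -[X in _ --> X](mulr0 K); apply: cvgM => //; exact: cvg_cst.
Qed.

(** * Cluster points of sequences in a compact set *)
Lemma closed_cluster (T : topologicalType) (F : set_system T) :
  closed (cluster F).
Proof. by rewrite clusterE; apply: closed_bigI => A _; exact: closed_closure. Qed.

(** If F did not contain U, its trace on the complement of U would be a proper
    filter on the compact set K; a cluster point of that trace is a cluster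
    point of F, hence in U, which the trace avoids. *)
Lemma cluster_sub_open (T : topologicalType) (F : set_system T) (K U : set T) :
  Filter F -> compact K -> F K -> open U -> cluster F `<=` U -> F U.
Proof.
move=> FF Kco FK oU FU; apply: contrapT => nFU.
have PG : ProperFilter (within (~` U) F).
  apply: Build_ProperFilter_ex => B FB; apply: contrapT => nB; apply: nFU.
  rewrite /within/= in FB.
  by apply: filterS FB => t tB; apply: contrapT => nUt; apply: nB; exists t; exact: tB.
have [|p [_ Gp]] := Kco _ PG.
  by rewrite /within /=; apply: filterS FK => t Kt _.
have Up : U p.
  by apply: FU => A B FA Bp; apply: Gp => //; rewrite /within /=; apply: filterS FA => t At _.
have [|q [/= nUq /nUq//]] := Gp (~` U) U _ (open_nbhs_nbhs (conj oU Up)).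
exact/nearW.
Qed.

Lemma compact_gap (R : realType) (V : normedModType R) (X Y : set V) :
  compact X -> compact Y -> X `&` Y = set0 ->
  exists2 d : R, 0 < d & forall a b, X a -> Y b -> d <= `|a - b|.
Proof.
move=> cX cY XY0; have [-> |X0] := eqVneq X set0; first by exists 1.
have [-> |Y0] := eqVneq Y set0; first by exists 1.
have [||c cXY cmin] := @compact_EVT_min _ R (fun p : V * V => `|p.1 - p.2|)
  (X `*` Y) _ (compact_setX cX cY).
- by move/set0P : X0 => [a Xa]; move/set0P : Y0 => [b Yb]; exists (a, b).
- apply: continuous_subspaceT => p.
  by apply: cvg_norm; apply: cvgB; [exact: cvg_fst|exact: cvg_snd].
move: cXY; rewrite inE => -[/= Xc Yc].
exists `|c.1 - c.2| => [|a b Xa Yb]; last by apply: (cmin (a, b)); rewrite inE.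
rewrite normr_gt0 subr_eq0; apply/eqP => c12; rewrite -c12 in Yc.
by have : (X `&` Y) c.1 by []; rewrite XY0.
Qed.

Section ClusterOfBoundedSequence.
Variables (R : realType) (V : normedModType R) (u : nat -> V) (K : set V).
Hypotheses (Kco : compact K) (uK : forall k, K (u k)).

Let omega := cluster (u @ \oo).

Let u_oo_K : (u @ \oo) K. Proof. by exists 0%N => /= [//|k _]; exact: uK. Qed.

Lemma cluster_seq_nonempty : omega !=set0.
Proof.
have [|p [_ ?]] := Kco (F := u @ \oo); last by exists p.
exact: u_oo_K.
Qed.

Lemma cluster_seq_compact : compact omega.
Proof.
apply: subclosed_compact (@closed_cluster _ _) Kco _ => p wp.
apply: (compact_closed (@norm_hausdorff _ V) Kco) => B Bp.
by apply: wp => //; exact: u_oo_K.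
Qed.

Lemma near_cluster_seq (U : set V) :
  open U -> omega `<=` U -> \forall k \near \oo, U (u k).
Proof. exact: cluster_sub_open Kco u_oo_K. Qed.

(** Ostrowski's argument: two separated pieces of the cluster set are compact,
    hence at a distance d > 0. The sequence is eventually within d / 3 of one of
    them and has steps shorter than d / 3, so it can never cross the gap, and
    the other piece contains no cluster point. *)
Lemma cluster_seq_connected :
  u k.+1 - u k @[k --> \oo] --> (0 : V) -> connected omega.
Proof.
move=> du0; apply/connectedP => E [E0 EU [sft stf]].
have Ecl b : closed (E b).
  move=> p Ep; have : omega p.
    apply: (@closed_cluster _ (u @ \oo)); rewrite -/omega EU.
    by apply: closure_subset Ep => q; case: b => ?; [right|left].
  rewrite EU; case: b Ep => Ep [] //.
    by move=> Efp; have : (E false `&` closure (E true)) p by []; rewrite stf.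
  by move=> Etp; have : (closure (E false) `&` E true) p by []; rewrite sft.
have Eco b : compact (E b).
  apply: subclosed_compact (Ecl b) cluster_seq_compact _; rewrite -/omega EU.
  by move=> p; case: b => ?; [right|left].
have [d d0 gap] : exists2 d : R, 0 < d &
    forall a b, E false a -> E true b -> d <= `|a - b|.
  apply: compact_gap => //; apply/seteqP; split=> // p [pf pt].
  by have : (closure (E false) `&` E true) p;
    [split=> //; exact: subset_closure|rewrite sft].
have d3 : 0 < d / 3 by lra.
pose U b := \bigcup_(a in E b) ball a (d / 3).
have oU b : open (U b) by apply: bigcup_open => a _; exact: ball_open.
have far b v w : U b v -> U (~~ b) w -> `|v - w| < d / 3 -> False.
  have base p q : U false p -> U true q -> `|p - q| < d / 3 -> False.
    move=> [a Ea]; rewrite -ball_normE/= => ap [c Ec]; rewrite -ball_normE/= => cq pq.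
    have := gap _ _ Ea Ec; apply/negP; rewrite -ltNge.
    have -> : a - c = (a - p) + (p - q) + (q - c) by rewrite !addrA !subrK.
    rewrite (le_lt_trans (ler_normD _ _))// (_ : d = d/3 + d/3 + d/3); last by lra.
    by rewrite ltrD// ?(distrC q)// (le_lt_trans (ler_normD _ _))// ltrD.
  by case: b => /= Uv Uw vw; [apply: (base w v) => //; rewrite distrC|apply: (base v w)].
have [N _ NP] : \forall k \near \oo, (U false `|` U true) (u k) /\
    `|u k.+1 - u k| < d / 3.
  near=> k; split; near: k.
    apply: near_cluster_seq; first exact: openU.
    rewrite EU => p [] Ep; [left|right]; exists p => //; exact: ballxx.
  have /cvgr0Pnorm_lt := du0; exact.
have [b Ub] : exists b, U b (u N).
  by have [[]] := NP N (leqnn N); [exists false|exists true].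
have stay k : U b (u (N + k)%N).
  elim: k => [|k ih]; first by rewrite addn0.
  rewrite addnS; have [_ dk] := NP (N + k)%N (leq_addr _ _).
  have [Us _] := NP (N + k).+1 (leqW (leq_addr _ _)).
  apply: contrapT => nU; apply: (far b _ _ ih _); last by rewrite distrC; exact: dk.
  by case: (b) Us nU => -[].
have [p Ep] := E0 (~~ b).
have : omega p by rewrite EU; case: (~~ b) Ep; [right|left].
move=> /(_ (U b) (ball p (d / 3))).
case.
- exists N => // k /= Nk.
  by rewrite -(subnKC Nk).
- exact: nbhsx_ballx.
move=> q [Uq]; rewrite -ball_normE/= distrC.
by apply: (far b) => //; exists p => //; exact: ballxx.
Unshelve. all: by end_near. Qed.

Lemma dist_cluster_cvg (ip : V -> V -> R) : euclidean ip ->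
  dist ip (u k) omega @[k --> \oo] --> 0%E.
Proof.
move=> E; have [C C0 CP] := ipnorm_le_norm E.
have near_lt (e : R) : 0 < e ->
    \forall k \near \oo, (0 <= dist ip (u k) omega < e%:E)%E.
  move=> e0; have eC0 : 0 < e / C by exact: divr_gt0.
  have := @near_cluster_seq (\bigcup_(a in omega) ball a (e / C)) _ _.
  case=> [|a wa|N _ NP].
  - by apply: bigcup_open => a _; exact: ball_open.
  - by exists a => //; exact: ballxx.
  exists N => // k /NP[a wa]; rewrite -ball_normE/= => ak; apply/andP; split.
    by apply: le_ereal_inf_tmp => _ [q _ <-]; rewrite lee_fin ipnorm_ge0.
  apply: (@le_lt_trans _ _ (ipnorm ip (u k - a))%:E).
    by apply: ereal_inf_lbound; exists a.
  by rewrite lte_fin (le_lt_trans (CP _))// mulrC -ltr_pdivlMr// distrC.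
have fin k (e : R) : (0 <= dist ip (u k) omega < e%:E)%E ->
    dist ip (u k) omega \is a fin_num.
  by move=> /andP[d0 de]; rewrite ge0_fin_numE// (lt_le_trans de)// leey.
apply/fine_cvgP; split; first by apply: filterS (near_lt 1 ltr01) => k; exact: fin.
apply/cvgr0Pnorm_lt => e e0; apply: filterS (near_lt e e0) => k /[dup] /fin dk.
by move=> /andP[d0 de]; rewrite /= ger0_norm ?fine_ge0// -lte_fin fineK.
Qed.

(** The strict inequality lets the subsequence be reindexed by predecessors. *)
Lemma cluster_seq_subsequence p : omega p ->
  exists2 phi : nat -> nat, (forall k, (k < phi k)%N) & u (phi k) @[k --> \oo] --> p.
Proof.
move=> wp.
have ex k : exists j, (k < j)%N /\ ball p k.+1%:R^-1 (u j).
  have [||_ [/= [j kj <-] pj]] := wp (u @` [set j | (k < j)%N]) (ball p k.+1%:R^-1).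
  - by exists k.+1 => // j kj; exists j.
  - by apply: nbhsx_ballx; rewrite invr_gt0.
  by exists j.
have [phi phiP] := choice ex; exists phi => [k|]; first by case: (phiP k).
apply/cvg_ballP => e e0; near=> k; have [_] := phiP k.
apply: le_ball; rewrite ltW//; near: k.
exact: near_infty_natSinv_lt (PosNum e0).
Unshelve. all: by end_near. Qed.

End ClusterOfBoundedSequence.

Lemma cV_box_compact (R : realType) N (C : R) :
  compact [set v : 'cV[R]_N | forall i, `|v i 0| <= C].
Proof.
have Bco := @rV_compact R N (fun=> `[- C, C]%classic) (fun=> @segment_compact _ _ _).
have -> : [set v : 'cV[R]_N | forall i, `|v i 0| <= C] =
    trmx @` [set v : 'rV[R]_N | forall i, `[- C, C]%classic (v ord0 i)].
  apply/seteqP; split => [v vC|_ [w wC <-] i].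
    by exists v^T; rewrite ?trmxK// => i; rewrite /= in_itv/= mxE -ler_norml.
  by have := wC i; rewrite /= in_itv/= mxE -ler_norml.
apply: continuous_compact => //; apply: continuous_subspaceT => w.
move=> B /nbhs_ballP[e e0 eB]; apply/nbhs_ballP; exists e => // v [_ wv].
by apply: eB; split=> // i j; rewrite !mxE.
Qed.

(** * Calculus of Frechet subgradients *)
Section Tangent.
Variables (R : realType) (V : normedModType R) (ip : V -> V -> R).
Implicit Types (Psi : V -> \bar R) (f : V -> R) (x d s : V).
Local Notation nrm := (ipnorm ip).

Definition lower_tangent Psi x d := forall e : R, 0 < e ->
  \forall v \near x, (Psi x + (ip d (v - x) - e * nrm (v - x))%:E <= Psi v)%E.

Definition is_gradient f x d := forall e : R, 0 < e ->
  \forall v \near x, `|f v - f x - ip d (v - x)| <= e * nrm (v - x).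

Hypothesis E : euclidean ip.

Lemma frechet_subdiffP Psi x d : (forall v, -oo < Psi v)%E ->
  frechet_subdiff ip Psi x d <-> (Psi x < +oo)%E /\ lower_tangent Psi x d.
Proof.
move=> Ny; suff H : (Psi x < +oo)%E -> (0 <= limf_einf
    (fun y => (Psi y - Psi x - (ip d (y - x)%R)%:E) * ((nrm (y - x)%R)^-1)%:E)
      (x^'))%E <-> lower_tangent Psi x d.
  by split=> -[fin]; [move/(H fin)|move/(H fin)].
case xa : (Psi x) (Ny x) => [a||] // _ _; rewrite limf_einfE; split=> [H|H].
- move=> e e0; rewrite xa.
  have e0' : (- e%:E < 0)%E by rewrite lte_fin oppr_lt0.
  have [_ [B xB <-] eB] := ereal_sup_gt (lt_le_trans e0' H).
  move: xB; rewrite /dnbhs /within /=; apply: filterS => v Bv.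
  have [->|vx] := eqVneq v x.
    by rewrite xa subrr (ip0r E) (ipnorm0 E) mulr0 subr0 adde0.
  have v0 : 0 < nrm (v - x) by apply: (ipnorm_gt0 E); rewrite subr_eq0.
  have := lt_le_trans eB (ereal_inf_lbound (ex_intro2 _ _ v (Bv vx) erefl)).
  case: (Psi v) (Ny v) => [b _||] //; last by rewrite leey.
  by rewrite -!EFinD -EFinM lte_fin lee_fin ltr_pdivlMr//; lra.
- apply/lee_addgt0Pr => e e0.
  rewrite -leeBlDr// sub0e; apply: le_ereal_sup_tmp.
  set B := [set v | v != x /\
    (Psi x + (ip d (v - x) - e * nrm (v - x))%:E <= Psi v)%E].
  exists (ereal_inf ((fun y => (Psi y - a%:E - (ip d (y - x)%R)%:E) *
    ((nrm (y - x)%R)^-1)%:E) @` B)%E).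
    exists B => //; rewrite /dnbhs /within /=.
    by apply: filterS (H e e0) => v; split.
  apply: le_ereal_inf_tmp => _ [v [vx vP] <-].
  have v0 : 0 < nrm (v - x) by apply: (ipnorm_gt0 E); rewrite subr_eq0.
  move: vP; rewrite xa; case: (Psi v) (Ny v) => [b _||] //; last first.
    by move=> _ _; rewrite !addye// gt0_mulye ?lte_fin ?invr_gt0// leey.
  by rewrite -!EFinD -EFinM !lee_fin ler_pdivlMr//; lra.
Qed.

Lemma argmin_lower_tangent Psi x : argmin Psi x -> lower_tangent Psi x 0.
Proof.
move=> xP e e0; apply: nearW => v; apply: le_trans (xP v).
rewrite -[leRHS]adde0 leeD// lee_fin (ip0l E) sub0r oppr_le0.
by rewrite mulr_ge0 ?ipnorm_ge0 ?ltW.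
Qed.

Lemma lower_tangentD Psi f x s d : lower_tangent Psi x s -> is_gradient f x d ->
  lower_tangent (fun v => Psi v + (f v)%:E)%E x (s + d).
Proof.
move=> Ps fd e e0; have e20 : 0 < e / 2 by lra.
apply: filterS2 (Ps _ e20) (fd _ e20) => v + /ler_normlP[+ _].
case: (Psi x) (Psi v) => [a||] [b||] //; rewrite ?leey ?leNye//.
by rewrite -!EFinD !lee_fin (ipDl E); lra.
Qed.

Lemma is_gradientN f x d : is_gradient f x d -> is_gradient (\- f) x (- d).
Proof.
move=> fd e e0; apply: filterS (fd e e0) => v; apply: le_trans.
by rewrite -normrN (ipNl E) le_eqVlt /=; apply/orP; left; apply/eqP; congr `|_|; ring.
Qed.

Lemma lower_tangentB Psi f x s d :
  lower_tangent (fun v => Psi v + (f v)%:E)%E x s -> is_gradient f x d ->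
  lower_tangent Psi x (s - d).
Proof.
move=> Ps /is_gradientN/(lower_tangentD Ps) /=.
by under eq_fun do rewrite -addeA -EFinD subrr adde0.
Qed.

Lemma is_gradientD f1 f2 x d1 d2 : is_gradient f1 x d1 -> is_gradient f2 x d2 ->
  is_gradient (f1 \+ f2) x (d1 + d2).
Proof.
move=> f1d f2d e e0; have e20 : 0 < e / 2 by lra.
apply: filterS2 (f1d _ e20) (f2d _ e20) => v H1 H2.
have -> : (f1 \+ f2) v - (f1 \+ f2) x - ip (d1 + d2) (v - x) =
   (f1 v - f1 x - ip d1 (v - x)) + (f2 v - f2 x - ip d2 (v - x)).
  by rewrite /= (ipDl E); ring.
by rewrite (le_trans (ler_normD _ _))//; lra.
Qed.

Lemma is_gradient_quadratic f x d (C : R) :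
  (forall v, `|f v - f x - ip d (v - x)| <= C * nrm (v - x) ^+ 2) ->
  is_gradient f x d.
Proof.
move=> fC e e0; have C0 : 0 < 1 + `|C| by rewrite ltr_wpDr.
have := near_ipnorm_lt E x (divr_gt0 e0 C0); apply: filterS => v.
rewrite ltr_pdivlMr// => H; apply: le_trans (fC v) _.
have := ipnorm_ge0 ip (v - x); have := ler_norm C.
by rewrite expr2 mulrA => HC v0; rewrite ler_wpM2r//; nra.
Qed.

(** Moving from x in the direction w = s - d by a small t > 0, the two
    first-order expansions leave t |w|^2 <= e t |w| for every e. *)
Lemma is_gradient_lower_tangent f x d s :
  is_gradient f x d -> lower_tangent (EFin \o f) x s -> s = d.
Proof.
move=> fd fs; apply/eqP; rewrite -subr_eq0; apply/negPn/negP => sd0.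
have n0 := ipnorm_gt0 E sd0; set w := s - d in sd0 n0.
have tan e : 0 < e -> \forall v \near x, ip w (v - x) <= e * nrm (v - x).
  move=> e0; have e20 : 0 < e / 2 by lra.
  apply: filterS2 (fs _ e20) (fd _ e20) => v + /ler_normlP[_].
  by rewrite -!EFinD lee_fin /w (ipBl E) /=; lra.
have n20 : 0 < nrm w / 2 by lra.
have /nbhs_ballP[r /= r0 rP] := tan _ n20.
have r1 : 0 < r / 2 / (1 + `|w|) by rewrite !divr_gt0// ltr_wpDr.
set t := r / 2 / (1 + `|w|) in r1.
have xt : ball x r (x + t *: w).
  rewrite -ball_normE /= opprD addrA subrr sub0r normrN normrZ gtr0_norm//.
  rewrite /t mulrAC ltr_pdivrMr ?ltr_wpDr//. have := normr_ge0 w => w0; nra.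
have := rP _ xt; rewrite (addrC x) addrK (ipZr E) (ipnormZ E) (gtr0_norm r1).
rewrite -(sqr_ipnorm E) expr2.
have : 0 < t * (nrm w * nrm w) by rewrite !mulr_gt0.
lra.
Qed.

Lemma argmin_is_gradient f x d : argmin f x -> is_gradient f x d -> d = 0.
Proof.
move=> xP fd; apply/esym; apply: is_gradient_lower_tangent fd _.
by apply: argmin_lower_tangent => v; rewrite lee_fin; exact: xP.
Qed.

End Tangent.

(** Chain rule for a map j that is short at w and whose adjoint sends d to d'.
    It serves both for the projections of a product onto its factors and for the
    inclusions of the factors as slices. *)
Section TangentComp.
Variables (R : realType) (V W : normedModType R).
Variables (ipV : V -> V -> R) (ipW : W -> W -> R).
Variables (j : W -> V) (w : W) (d : V) (d' : W).
Hypotheses (EV : euclidean ipV) (EW : euclidean ipW).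
Hypothesis jle : forall w', ipnorm ipV (j w' - j w) <= ipnorm ipW (w' - w).
Hypothesis jd : forall w', ipV d (j w' - j w) = ipW d' (w' - w).

Let jc : {for w, continuous j}.
Proof.
apply: (@cvg_ipnorm_le _ _ _ ipW ipV _ _ (nbhs_filter w) id j w (j w) 1) => //.
by move=> w'; rewrite mul1r.
Qed.

Lemma lower_tangent_comp (Psi : V -> \bar R) :
  lower_tangent ipV Psi (j w) d -> lower_tangent ipW (Psi \o j) w d'.
Proof.
move=> Pd e e0; have : nbhs w (j @^-1` _) := jc (Pd e e0).
apply: filterS => w' /=; apply: le_trans.
by rewrite leeD2l// lee_fin jd lerD2l lerN2 ler_wpM2l// ltW.
Qed.

Lemma is_gradient_comp (f : V -> R) :
  is_gradient ipV f (j w) d -> is_gradient ipW (f \o j) w d'.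
Proof.
move=> fd e e0; have : nbhs w (j @^-1` _) := jc (fd e e0).
apply: filterS => w' /=; rewrite jd => /le_trans.
by apply; rewrite ler_wpM2l// ltW.
Qed.

End TangentComp.

(** * Matrices, eigenvalues and the descent lemma *)
Lemma coord_le_norm (R : realType) N (v : 'cV[R]_N) i : `|v i 0| <= `|v|.
Proof.
by rewrite [leRHS]/Num.Def.normr /= mx_normrE; apply/bigmax_geP; right; exists (i, 0).
Qed.

Lemma euclidean_dotv (R : realType) N : euclidean (@dotv R N).
Proof.
split=> [u v|a u v w|u|].
- by apply: eq_bigr => i _; rewrite mulrC.
- rewrite /dotv mulr_sumr -big_split /=; apply: eq_bigr => i _.
  by rewrite !mxE mulrDl mulrA.
- have d0 : 0 <= dotv u u by apply: sumr_ge0 => i _; rewrite -expr2 sqr_ge0.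
  have -> : dotv u u = Num.sqrt (dotv u u) ^+ 2 by rewrite sqr_sqrtr.
  rewrite ler_pXn2r ?nnegrE// [leLHS]/Num.Def.normr /= mx_normrE.
  apply/bigmax_leP; split=> [|[i j] _ /=]; first exact: sqrtr_ge0.
  rewrite ord1 -(@ler_pXn2r _ 2) ?nnegrE// sqr_sqrtr// real_normK ?num_real//.
  rewrite /dotv (bigD1 i)//= -expr2 lerDl sumr_ge0// => k _.
  by rewrite -expr2 sqr_ge0.
- exists N%:R => u; rewrite -[N in N%:R]card_ord -sumr_const mulr_suml.
  apply: ler_sum => i _; rewrite mul1r -expr2 -(real_normK (num_real _)).
  by rewrite ler_pXn2r ?nnegrE// coord_le_norm.
Qed.

Lemma euclidean_dot3 (R : realType) n m : euclidean (@dot3 R n m).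
Proof.
have En := @euclidean_dotv R n; have Em := @euclidean_dotv R m.
split=> [u v|a u v w|u|].
- by rewrite /dot3; congr (_ + _ + _); exact: euclideanC.
- by rewrite /dot3 /= (euclideanP En) !(euclideanP Em); ring.
- have := sqr_norm_le_ip En u.1.1; have := sqr_norm_le_ip Em u.1.2.
  have := sqr_norm_le_ip Em u.2; have := ip_ge0 En u.1.1.
  have := ip_ge0 Em u.1.2; have := ip_ge0 Em u.2; rewrite /dot3.
  move: (dotv _ _) (dotv _ _) (dotv _ _) => a b c a0 b0 c0.
  rewrite ![`|u|]prod_normE ![`|u.1|]prod_normE => H1 H2 H3.
  by case: (leP `|u.1.1| _) => _; case: (leP _ `|u.2|) => _; lra.
- have [C CP] := ip_le_sqr_norm En; have [D DP] := ip_le_sqr_norm Em.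
  exists (`|C| + `|D| + `|D|) => u.
  have le1 : `|u.1.1| <= `|u|.
    by rewrite [`|u|]prod_normE [`|u.1|]prod_normE !le_max lexx.
  have le2 : `|u.1.2| <= `|u|.
    by rewrite [`|u|]prod_normE [`|u.1|]prod_normE !le_max lexx orbT.
  have le3 : `|u.2| <= `|u| by rewrite [`|u|]prod_normE le_max lexx orbT.
  have aux (c s t : R) : 0 <= s -> s <= t -> c * s ^+ 2 <= `|c| * t ^+ 2.
    move=> s0 st; rewrite (le_trans (ler_wpM2r (sqr_ge0 s) (ler_norm c)))//.
    by rewrite ler_wpM2l// ler_pXn2r ?nnegrE// (le_trans s0).
  by rewrite /dot3 !mulrDl !lerD// (le_trans (CP _) (aux _ _ _ _ _))
    || rewrite /dot3 !mulrDl !lerD ?(le_trans (CP _) (aux _ _ _ _ _))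
       ?(le_trans (DP _) (aux _ _ _ _ _)).
Qed.

Section Matrices.
Variable R : realType.

Lemma sqr_enorm N (x : 'cV[R]_N) : enorm x ^+ 2 = dotv x x.
Proof. exact: (sqr_ipnorm (euclidean_dotv _ _)). Qed.

Lemma enorm_ge0 N (x : 'cV[R]_N) : 0 <= enorm x.
Proof. exact: ipnorm_ge0. Qed.

Lemma enormZ N a (x : 'cV[R]_N) : enorm (a *: x) = `|a| * enorm x.
Proof. exact: (ipnormZ (euclidean_dotv _ _)). Qed.

Lemma dotv_mulmx p q (A : 'M[R]_(p, q)) x y :
  dotv (A *m x) y = dotv x (A^T *m y).
Proof.
have dotvE N (u v : 'cV[R]_N) : dotv u v = (u^T *m v) 0 0.
  by rewrite mxE; apply: eq_bigr => i _; rewrite mxE.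
by rewrite !dotvE trmx_mul -mulmxA.
Qed.

Lemma dotv_sym N (M : 'M[R]_N) x y : M^T = M -> dotv (M *m x) y = dotv (M *m y) x.
Proof.
by move=> MT; rewrite dotv_mulmx MT (euclideanC (euclidean_dotv _ _)).
Qed.

Lemma enorm_mulmx_le p q (A : 'M[R]_(p, q)) :
  exists2 C, 0 <= C & forall x, enorm (A *m x) <= C * enorm x.
Proof.
pose C2 := \sum_i enorm (row i A)^T ^+ 2.
have C20 : 0 <= C2 by apply: sumr_ge0 => i _; exact: sqr_ge0.
exists (Num.sqrt C2) => [|x]; first exact: sqrtr_ge0.
rewrite -(@ler_pXn2r _ 2) ?nnegrE ?mulr_ge0 ?sqrtr_ge0//.
rewrite exprMn [enorm (A *m x) ^+ 2]sqr_enorm [Num.sqrt C2 ^+ 2]sqr_sqrtr// mulr_suml.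
apply: ler_sum => i _; rewrite -expr2 -(real_normK (num_real _)).
rewrite -exprMn ler_pXn2r ?nnegrE ?mulr_ge0 ?sqrtr_ge0//.
have -> : (A *m x) i 0 = dotv (row i A)^T x.
  by rewrite mxE; apply: eq_bigr => j _; rewrite !mxE.
exact: (cauchy_schwarz (euclidean_dotv _ _)).
Qed.

Lemma opnormP p q (A : 'M[R]_(p, q)) x : enorm (A *m x) <= opnorm A * enorm x.
Proof.
have [C C0 CP] := enorm_mulmx_le A.
have E := @euclidean_dotv R q.
have [->|x0] := eqVneq x 0.
  by rewrite mulmx0 /enorm !(ipnorm0 (euclidean_dotv _ _)) mulr0.
have n0 : 0 < enorm x by exact: (ipnorm_gt0 E).
rewrite -ler_pdivrMr// mulrC -[(enorm x)^-1]gtr0_norm ?invr_gt0//.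
rewrite /enorm -(ipnormZ (euclidean_dotv _ _)) -/(enorm _) scalemxAr.
apply: ub_le_sup.
  exists C => _ [y /= y1 <-]; rewrite (le_trans (CP y))//.
  by rewrite -[leRHS]mulr1 ler_wpM2l.
exists ((enorm x)^-1 *: x) => //=.
by rewrite /enorm (ipnormZ E) gtr0_norm ?invr_gt0// mulVf// gt_eqF.
Qed.

Lemma cvg_mulmx p q (A : 'M[R]_(p, q)) (T : Type) (F : set_system T)
    (FF : Filter F) (f : T -> 'cV[R]_q) l :
  f @ F --> l -> A *m f t @[t --> F] --> A *m l.
Proof.
have [C C0 CP] := enorm_mulmx_le A.
apply: cvg_ipnorm_le (euclidean_dotv _ _) (euclidean_dotv _ _) _ => t.
by rewrite -mulmxBr; exact: CP.
Qed.

Lemma continuous_mulmx p q (A : 'M[R]_(p, q)) :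
  continuous (mulmx A : 'cV[R]_q -> 'cV[R]_p).
Proof.
move=> y; exact: (@cvg_mulmx _ _ A _ _ (nbhs_filter y) id y).
Qed.

(** The minimum c of |A^T y|^2 over the unit sphere is attained at some y0 by
    compactness, and c > 0 because A^T is injective. The function
    |A^T y|^2 - c |y|^2 is nonnegative and vanishes at y0, so its gradient there
    is 0: y0 is an eigenvector of A A^T for c. Every other eigenvalue is a
    Rayleigh quotient, hence at least c. *)
Lemma lambda_min_surjective p q (A : 'M[R]_(p, q)) : (0 < p)%N ->
  (forall z : 'cV[R]_p, exists x : 'cV[R]_q, A *m x = z) ->
  0 < lambda_min (A *m A^T) /\
  forall y, lambda_min (A *m A^T) * enorm y ^+ 2 <= enorm (A^T *m y) ^+ 2.
Proof.
move=> p0 Asurj; have E := @euclidean_dotv R p; have Eq := @euclidean_dotv R q.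
have sphco : compact [set v : 'cV[R]_p | dotv v v = 1].
  apply: (subclosed_compact _ (@cV_box_compact R p 1)).
    apply: (@preimage_closed _ _ (fun v : 'cV[R]_p => dotv v v) [set 1]).
      by move=> v _; apply: (cvg_ip E (nbhs_filter v)); exact: cvg_id.
    exact: closed_eq.
  move=> v /= v1 i; rewrite (le_trans (coord_le_norm v i))//.
  by rewrite (le_trans (norm_le_ipnorm E v))// /ipnorm v1 sqrtr1.
have [||y0] := @compact_EVT_min _ R (fun y => dotv (A^T *m y) (A^T *m y)) _ _ sphco.
- exists (delta_mx (Ordinal p0) 0); rewrite /dotv /=.
  rewrite (bigD1 (Ordinal p0))//= big1 => [|i i0]; rewrite !mxE.
    by rewrite eqxx mulr1 addr0.
  by rewrite (negbTE i0) mul0r.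
- apply: continuous_subspaceT => y.
  by apply: (cvg_ip Eq (nbhs_filter y)); exact: continuous_mulmx.
rewrite inE /= => y01 ymin; set c := dotv (A^T *m y0) (A^T *m y0) in ymin.
have cP y : c * dotv y y <= dotv (A^T *m y) (A^T *m y).
  have [->|yn0] := eqVneq y 0; first by rewrite mulmx0 !(ip0r E) (ip0r Eq) mulr0.
  have n0 := ipnorm_gt0 E yn0.
  have := ymin ((enorm y)^-1 *: y); rewrite inE /= -scalemxAr !(ipZl Eq) !(ipZr Eq).
  rewrite !(ipZl E) !(ipZr E) -sqr_enorm => H.
  have /H : (enorm y)^-1 * ((enorm y)^-1 * enorm y ^+ 2) = 1.
    by rewrite expr2 mulKf ?mulVf// gt_eqF.
  rewrite -sqr_enorm -ler_pdivlMr ?exprn_gt0//; move/le_trans; apply.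
  by rewrite expr2 invfM mulrA [leRHS]mulrC.
have c0 : 0 < c.
  rewrite lt_def ip_ge0// andbT; apply/eqP => c0.
  have Ay0 : A^T *m y0 = 0.
    by apply: (ipnorm_eq0 Eq); rewrite /ipnorm -/c c0 sqrtr0.
  have [x xP] := Asurj y0; move: y01; rewrite -[in X in dotv X _]xP dotv_mulmx.
  by rewrite Ay0 (ip0r Eq) => /esym/eqP; rewrite oner_eq0.
have eig : A *m (A^T *m y0) = c *: y0.
  have [K K0 KP] := enorm_mulmx_le A^T.
  pose f (y : 'cV[R]_p) := dotv (A^T *m y) (A^T *m y) - c * dotv y y.
  have : argmin f y0.
    by move=> y; rewrite /f y01 mulr1 subrr subr_ge0; exact: cP.
  have fd : is_gradient (@dotv R p) f y0 (2 *: (A *m (A^T *m y0) - c *: y0)).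
    apply: (is_gradient_quadratic E (C := K ^+ 2 + c)) => v.
    have -> : f v - f y0 - dotv (2 *: (A *m (A^T *m y0) - c *: y0)) (v - y0) =
        enorm (A^T *m (v - y0)) ^+ 2 - c * enorm (v - y0) ^+ 2.
      rewrite /f !sqr_enorm (ipZl E) (ipBl E) (ipZl E) (dotv_mulmx A) mulmxBr.
      rewrite !(ipBl E) !(ipBr E) !(ipBl Eq) !(ipBr Eq).
      by rewrite (euclideanC E v y0) (euclideanC Eq (A^T *m v) (A^T *m y0)); ring.
    have KP2 : enorm (A^T *m (v - y0)) ^+ 2 <= K ^+ 2 * enorm (v - y0) ^+ 2.
      by rewrite -exprMn ler_pXn2r ?nnegrE ?mulr_ge0 ?enorm_ge0.
    rewrite -/(enorm (v - y0)) mulrDl; apply/ler_normlP.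
    have := mulr_ge0 (ltW c0) (sqr_ge0 (enorm (v - y0))).
    have := sqr_ge0 (enorm (A^T *m (v - y0))).
    by move=> h1 h2; split; lra.
  move=> /(argmin_is_gradient E)/(_ fd)/eqP.
  by rewrite scaler_eq0 pnatr_eq0 /= subr_eq0 => /eqP.
have -> : lambda_min (A *m A^T) = c.
  have ceig : eigenvalue (A *m A^T) c.
    apply/eigenvalueP; exists y0^T.
      have -> : c *: y0^T = (c *: y0)^T by rewrite linearZ.
      by rewrite -eig !trmx_mul trmxK mulmxA.
    by rewrite trmx_eq0; apply: contra_eq_neq y01 => ->; rewrite (ip0r E) eq_sym oner_eq0.
  have clb : lbound [set a | eigenvalue (A *m A^T) a] c.
    move=> a /eigenvalueP[v va v0].
    have vT0 : v^T != 0 by rewrite trmx_eq0.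
    have : 0 < dotv v^T v^T by rewrite -sqr_enorm exprn_gt0// (ipnorm_gt0 E).
    move/ler_pM2r <-; apply: le_trans (cP _) _; rewrite -(ipZl E).
    have -> : a *: v^T = A *m (A^T *m v^T).
      by have := congr1 trmx va; rewrite !trmx_mul trmxK linearZ /= mulmxA => <-.
    by rewrite (dotv_mulmx A).
  apply/le_anti/andP; split; first by apply: ge_inf => //; exists c.
  by apply: lb_le_inf => //; exists c.
by split=> // y; rewrite !sqr_enorm.
Qed.

End Matrices.

Section Gradient.
Variables (R : realType) (N : nat) (h : 'cV[R]_N -> R).
Let E := @euclidean_dotv R N.

Lemma differentiable_is_gradient x : differentiable (h : 'cV[R]_N -> R^o) x ->
  is_gradient (@dotv R N) h x (grad h x).
Proof.
move=> dh e e0; have /eqaddoP/(_ e e0) := diff_locally dh.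
move=> /nbhs_ballP[r /= r0 rP]; apply/nbhs_ballP; exists r => // v.
rewrite -ball_normE /= -normrN opprB => xv.
have := rP (v - x); rewrite -ball_normE /= sub0r normrN => /(_ xv) /= H.
rewrite -gradP// -opprB; move: H; rewrite /= !fctE /= subrK opprD addrA.
move/le_trans; rewrite opprB; apply; apply: ler_wpM2l (ltW e0) _ _ _; exact: norm_le_ipnorm E _.
Qed.

Hypothesis dh : forall x, differentiable (h : 'cV[R]_N -> R^o) x.

Lemma is_derive_line x v (t : R) :
  is_derive t 1 (fun t => h (x + t *: v)) (dotv (grad h (x + t *: v)) v).
Proof.
have fE : (fun s : R => s^-1 *: (((fun t => h (x + t *: v)) \o shift t) (s *: 1)
    - h (x + t *: v))) =
  (fun s => s^-1 *: ((h \o shift (x + t *: v)) (s *: v) - h (x + t *: v))).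
  apply/funext => s /=; congr (_ *: (h _ - _)).
  by rewrite [s *: 1]mulr1 scalerDl addrCA.
have dv : derivable (h : 'cV[R]_N -> R^o) (x + t *: v) v by exact: diff_derivable.
split; first by rewrite /derivable fE.
by rewrite /derive fE -gradP// -deriveE.
Qed.

(** The two versions of the descent lemma, with the gradient taken at either end
    of the segment, come from two affine bounds on the derivative along it. *)
Lemma increment_le x v (c d : R) :
  (forall t, 0 <= t <= 1 -> dotv (grad h (x + t *: v)) v <= c + d * t) ->
  h (x + v) - h x <= c + d / 2.
Proof.
move=> H.
pose f (t : R) := h (x + t *: v) - (c * t + d / 2 * t ^+ 2).
have df (t : R) : is_derive t 1 f (dotv (grad h (x + t *: v)) v - (c + d * t)).
  have hd := is_derive_line x v t.
  have -> : f = (fun t => h (x + t *: v)) - (c \*: id + (d / 2) \*: (id ^+ 2)).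
    by apply/funext => s; rewrite /f !fctE /=.
  apply: is_derive_eq; rewrite /=.
  rewrite expr1 -![_%:A]/(_ * 1) -[(d / 2) *: _]/(_ * _) !mulr1.
  by congr (_ - (_ + _)); rewrite mulrA divfK.
have cf : {within `[0, 1], continuous f}.
  apply: continuous_subspaceT => t.
  apply: differentiable_continuous; apply/derivable1_diffP; by case: (df t).
suff : f 1 <= f 0 by rewrite /f scale1r scale0r addr0 expr1n expr0n /=; lra.
apply: (@ler0_derive1_nincr R f 0 1) => // t; rewrite in_itv/= => /andP[t0 t1].
by rewrite derive1E (@derive_val _ _ _ _ _ _ _ (df t)) subr_le0 H// !ltW.
Qed.

Variables (L : R).
Hypothesis h_lip : forall x y, enorm (grad h x - grad h y) <= L * enorm (x - y).

Lemma descent_lemma x v :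
  h (x + v) - h x <= dotv (grad h x) v + L / 2 * enorm v ^+ 2.
Proof.
rewrite (_ : L / 2 * _ = L * enorm v ^+ 2 / 2); last by ring.
apply: increment_le => t /andP[t0 _].
rewrite -lerBlDl -(ipBl E) (le_trans (ip_le E _ _))//.
have := h_lip (x + t *: v) x.
have -> : x + t *: v - x = t *: v by rewrite addrC addKr.
rewrite enormZ ger0_norm// => H.
apply: le_trans (ler_wpM2r (enorm_ge0 v) H) _.
by have -> : L * (t * enorm v) * enorm v = L * enorm v ^+ 2 * t by ring.
Qed.

(** Along the segment the distance to the end point is (1 - t) |v|, whence the
    decreasing affine bound. *)
Lemma descent_lemma_end x v :
  h (x + v) - h x <= dotv (grad h (x + v)) v + L / 2 * enorm v ^+ 2.
Proof.
rewrite [leRHS](_ : _ = dotv (grad h (x + v)) v + L * enorm v ^+ 2 +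
  - (L * enorm v ^+ 2) / 2); last by field.
apply: increment_le => t /andP[t0 t1].
rewrite -addrA -lerBlDl -(ipBl E) (le_trans (ip_le E _ _))//.
have := h_lip (x + t *: v) (x + v).
have -> : x + t *: v - (x + v) = (t - 1) *: v.
  by rewrite opprD addrACA subrr add0r scalerBl scale1r.
rewrite enormZ.
rewrite distrC ger0_norm ?subr_ge0// => H.
apply: le_trans (ler_wpM2r (enorm_ge0 v) H) _.
have -> : L * ((1 - t) * enorm v) * enorm v =
  L * enorm v ^+ 2 + - (L * enorm v ^+ 2) * t by ring.
exact: lexx.
Qed.

End Gradient.

(** * One iteration *)
Section OneStep.
Variable R : realType.

(** The quadratic part of both subproblems: directly for the x-step, and with
    A replaced by - 1%:M and z by - A x for the z-step. *)
Definition penalized p q (A : 'M[R]_(p, q)) (r : R) (M : 'M[R]_q)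
    (y z : 'cV[R]_p) (c v : 'cV[R]_q) : R :=
  dotv y (A *m v - z) + r / 2 * enorm (A *m v - z) ^+ 2
  + 2^-1 * sqnorm_mx M (v - c).

Definition penalized_grad p q (A : 'M[R]_(p, q)) (r : R) (M : 'M[R]_q)
    (y z : 'cV[R]_p) (c v : 'cV[R]_q) : 'cV[R]_q :=
  A^T *m (y + r *: (A *m v - z)) + M *m (v - c).

Lemma penalized_expand p q (A : 'M[R]_(p, q)) r M y z c u v : M^T = M ->
  penalized A r M y z c v - penalized A r M y z c u =
  dotv (penalized_grad A r M y z c u) (v - u)
  + r / 2 * enorm (A *m (v - u)) ^+ 2 + 2^-1 * sqnorm_mx M (v - u).
Proof.
move=> MT; have Ep := @euclidean_dotv R p; have Eq := @euclidean_dotv R q.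
rewrite /penalized /penalized_grad /sqnorm_mx.
have -> : A *m v - z = (A *m u - z) + A *m (v - u).
  by rewrite mulmxBr [RHS]addrC addrA subrK.
have -> : v - c = (u - c) + (v - u) by rewrite [RHS]addrC addrA subrK.
move: (v - u) (u - c) (A *m u - z) => d e f.
rewrite !sqr_enorm mulmxDr !(ipDl Eq) !(ipDr Eq) !(ipDl Ep) !(ipDr Ep).
rewrite (dotv_sym e d MT) (euclideanC Eq (A^T *m _)) -(dotv_mulmx A).
rewrite (ipDr Ep) (ipZr Ep) (euclideanC Ep (A *m d) y) (euclideanC Ep f).
by field.
Qed.

Lemma sqnorm_mx_le N (M : 'M[R]_N) c v :
  (forall u, enorm (M *m u) <= c * enorm u) -> `|sqnorm_mx M v| <= c * enorm v ^+ 2.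
Proof.
move=> Mc; rewrite (le_trans (cauchy_schwarz (euclidean_dotv _ _) _ _))//.
by rewrite expr2 mulrA; exact: ler_wpM2r (enorm_ge0 v) _ _ (Mc v).
Qed.

Lemma is_gradient_penalized p q (A : 'M[R]_(p, q)) r M y z c u : M^T = M ->
  is_gradient (@dotv R q) (penalized A r M y z c) u (penalized_grad A r M y z c u).
Proof.
move=> MT; have [K K0 KP] := enorm_mulmx_le A; have [c' c0 cP] := enorm_mulmx_le M.
apply: (is_gradient_quadratic (euclidean_dotv _ _)
  (C := `|r / 2| * K ^+ 2 + 2^-1 * c')) => v.
have cancel (a b c1 : R) : a + b + c1 - a = b + c1 by ring.
rewrite penalized_expand// cancel mulrDl.
rewrite (le_trans (ler_normD _ _))// lerD//.
  rewrite normrM -mulrA ler_wpM2l// ger0_norm ?sqr_ge0// -exprMn.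
  by rewrite ler_pXn2r ?nnegrE ?mulr_ge0 ?enorm_ge0 ?KP//; exact: KP.
rewrite normrM -mulrA ger0_norm ?invr_ge0// ler_wpM2l ?invr_ge0//.
exact: sqnorm_mx_le.
Qed.

(** Expand the quadratic part around the minimizer u: the linear term is
    - <d, c - u> by optimality and cancels the one of the descent lemma. What
    remains is half the quadratic form of 2 M + r A^T A - L at u - c. *)
Lemma x_step_decrease p q (A : 'M[R]_(p, q)) r M y z c u d (L kappa : R) h1 h0 :
  M^T = M -> d + penalized_grad A r M y z c u = 0 ->
  h1 - h0 <= dotv d (u - c) + L / 2 * enorm (u - c) ^+ 2 ->
  loewner_ge (2 *: M + r *: (A^T *m A)) (L + kappa)%:M ->
  h1 + dotv y (A *m u - z) + r / 2 * enorm (A *m u - z) ^+ 2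
    + kappa / 2 * enorm (u - c) ^+ 2 <=
  h0 + dotv y (A *m c - z) + r / 2 * enorm (A *m c - z) ^+ 2.
Proof.
move=> MT opt dec /(_ (u - c)).
have Ep := @euclidean_dotv R p; have Eq := @euclidean_dotv R q.
have := penalized_expand A r y z c u c MT.
have -> : penalized_grad A r M y z c u = - d.
  by apply/eqP; rewrite -addr_eq0 addrC opt.
rewrite /penalized /sqnorm_mx subrr mulmx0 (ip0r Eq) mulr0 addr0.
rewrite -(opprB u c) !mulmxN (ipNl Eq) !(ipNr Eq) opprK (ipNl Eq) opprK.
rewrite mul_scalar_mx mulmxDl -!scalemxAl -!mulmxA (ipDl Eq) !(ipZl Eq).
rewrite [dotv (A^T *m _) _]dotv_mulmx trmxK.
rewrite /enorm (ipnormN Ep) -!/(enorm _) !sqr_enorm.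
move: dec; rewrite sqr_enorm.
lra.
Qed.

(** Coefficient of the telescoping term in [dual_step]; the coefficient of
    |w|^2 there is the constant T0. *)
Definition dual_T1 (lam rho : R) : R :=
  if rho <= 1 then (1 - rho) / (lam * rho ^+ 2)
  else (rho - 1) / (lam * rho * (2 - rho)).

(** Convexity of the squared norm. For rho <= 1, a1 is the convex combination
    (1 - rho) a0 + rho w. For rho > 1 it is the convex combination, with
    weights rho - 1 and 2 - rho, of - a0 and rho / (2 - rho) w. *)
Lemma dual_step N N' (a0 a1 w : 'cV[R]_N) (dy : 'cV[R]_N') (lam rho : R) :
  0 < lam -> 0 < rho < 2 -> lam * enorm dy ^+ 2 <= enorm a1 ^+ 2 ->
  a1 = (1 - rho) *: a0 + rho *: w ->
  enorm dy ^+ 2 / rho <= dual_T1 lam rho * (enorm a0 ^+ 2 - enorm a1 ^+ 2)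
    + (if rho <= 1 then 1 / (lam * rho) else rho / (lam * (2 - rho) ^+ 2))
      * enorm w ^+ 2.
Proof.
move=> l0 /andP[rho0 rho2] dya a1E; have E := @euclidean_dotv R N.
have a1sq : enorm a1 ^+ 2 = (1 - rho) ^+ 2 * enorm a0 ^+ 2
   + 2 * rho * (1 - rho) * dotv a0 w + rho ^+ 2 * enorm w ^+ 2.
  rewrite a1E !sqr_enorm !(ipDl E) !(ipDr E) !(ipZl E) !(ipZr E).
  by rewrite (euclideanC E w); ring.
rewrite /dual_T1; case: ifPn => [rho1|]; last rewrite -ltNge => rho1.
  (* The defect in the convexity inequality is this square. *)
- have : 0 <= (1 - rho) * rho * enorm (a0 - w) ^+ 2.
    by apply: mulr_ge0 (sqr_ge0 _); apply: mulr_ge0 (ltW rho0); rewrite subr_ge0.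
  rewrite [X in _ * X]sqr_enorm !(ipBl E) !(ipBr E) (euclideanC E w) -!sqr_enorm.
  move=> H; rewrite -(ler_pM2l (mulr_gt0 l0 (exprn_gt0 2 rho0))).
  rewrite [leLHS](_ : _ = rho * (lam * enorm dy ^+ 2)); last by field; rewrite gt_eqF.
  rewrite (le_trans (ler_wpM2l (ltW rho0) dya))//.
  rewrite [leRHS](_ : _ = (1 - rho) * (enorm a0 ^+ 2 - enorm a1 ^+ 2)
    + rho * enorm w ^+ 2); last by field; rewrite !gt_eqF.
  by rewrite a1sq in H *; nra.
- have r20 : 0 < 2 - rho by lra.
  have : 0 <= (rho - 1) * enorm ((2 - rho) *: a0 + rho *: w) ^+ 2.
    by rewrite mulr_ge0 ?sqr_ge0// subr_ge0 ltW.
  rewrite [X in _ * X]sqr_enorm !(ipDl E) !(ipDr E) !(ipZl E) !(ipZr E).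
  rewrite (euclideanC E w) -!sqr_enorm => H.
  have D0 : 0 < lam * rho * (2 - rho) ^+ 2 by rewrite !mulr_gt0 ?exprn_gt0.
  rewrite -(ler_pM2l D0).
  rewrite [leLHS](_ : _ = (2 - rho) ^+ 2 * (lam * enorm dy ^+ 2)); last first.
    by field; rewrite gt_eqF.
  rewrite (le_trans (ler_wpM2l (sqr_ge0 _) dya))//.
  rewrite [leRHS](_ : _ = (2 - rho) * (rho - 1) * (enorm a0 ^+ 2 - enorm a1 ^+ 2)
    + rho ^+ 2 * enorm w ^+ 2); last by field; rewrite !gt_eqF.
  by rewrite a1sq in H *; nra.
Qed.

Lemma dual_T1_ge0 (lam rho : R) : 0 < lam -> 0 < rho < 2 -> 0 <= dual_T1 lam rho.
Proof.
move=> l0 /andP[rho0 rho2]; rewrite /dual_T1; case: ifPn => [rho1|].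
  by rewrite divr_ge0 ?subr_ge0// mulr_ge0 ?sqr_ge0 ?ltW.
rewrite -ltNge => rho1; rewrite divr_ge0 ?subr_ge0 ?ltW// !mulr_gt0//.
by rewrite subr_gt0.
Qed.

End OneStep.

(** * The augmented Lagrangian and its critical points *)
Section Lagrangian.
Variables (R : realType) (n m : nat).
Variables (g : 'cV[R]_m -> \bar R) (h : 'cV[R]_n -> R) (A : 'M[R]_(m, n)) (r : R).

Let En := @euclidean_dotv R n.
Let Em := @euclidean_dotv R m.
Let E3 := @euclidean_dot3 R n m.

Local Notation space := ('cV[R]_n * 'cV[R]_m * 'cV[R]_m)%type.
Implicit Types p q : space.

Lemma sqr_enorm3 p :
  enorm3 p ^+ 2 = enorm p.1.1 ^+ 2 + enorm p.1.2 ^+ 2 + enorm p.2 ^+ 2.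
Proof. by rewrite !sqr_enorm [LHS](sqr_ipnorm E3). Qed.

Lemma enorm_x_le p : enorm p.1.1 <= enorm3 p.
Proof.
rewrite -(@ler_pXn2r _ 2) ?nnegrE ?enorm_ge0 ?ipnorm_ge0// sqr_enorm3.
by rewrite -addrA lerDl addr_ge0 ?sqr_ge0.
Qed.

Lemma enorm_z_le p : enorm p.1.2 <= enorm3 p.
Proof.
rewrite -(@ler_pXn2r _ 2) ?nnegrE ?enorm_ge0 ?ipnorm_ge0// sqr_enorm3.
by rewrite addrAC lerDr addr_ge0 ?sqr_ge0.
Qed.

Lemma enorm_y_le p : enorm p.2 <= enorm3 p.
Proof.
rewrite -(@ler_pXn2r _ 2) ?nnegrE ?enorm_ge0 ?ipnorm_ge0// sqr_enorm3.
by rewrite lerDr addr_ge0 ?sqr_ge0.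
Qed.

Definition residual p := A *m p.1.1 - p.1.2.

(** Everything but g: a differentiable function, so that subgradients of the
    Lagrangian are those of g plus a gradient. *)
Definition lag_smooth p : R :=
  h p.1.1 + dotv p.2 (residual p) + r / 2 * enorm (residual p) ^+ 2.

Lemma aug_lagrangianE p :
  aug_lagrangian g h A r p = (g p.1.2 + (lag_smooth p)%:E)%E.
Proof. by move: p => [[]]. Qed.

Definition lag_smooth_grad p : space :=
  (grad h p.1.1 + A^T *m (p.2 + r *: residual p), - (p.2 + r *: residual p),
   residual p).

Lemma residualD p q : residual (p + q) = residual p + residual q.
Proof. by rewrite /residual /= mulmxDr opprD addrACA. Qed.

Lemma cvg_x (T : Type) (F : set_system T) (FF : Filter F) (f : T -> space) p :
  f @ F --> p -> (f t).1.1 @[t --> F] --> p.1.1.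
Proof.
apply: (cvg_ipnorm_le FF (K := 1) E3 En) => t.
by rewrite mul1r; exact: (enorm_x_le (f t - p)).
Qed.

Lemma cvg_z (T : Type) (F : set_system T) (FF : Filter F) (f : T -> space) p :
  f @ F --> p -> (f t).1.2 @[t --> F] --> p.1.2.
Proof.
apply: (cvg_ipnorm_le FF (K := 1) E3 Em) => t.
by rewrite mul1r; exact: (enorm_z_le (f t - p)).
Qed.

Lemma cvg_y (T : Type) (F : set_system T) (FF : Filter F) (f : T -> space) p :
  f @ F --> p -> (f t).2 @[t --> F] --> p.2.
Proof.
apply: (cvg_ipnorm_le FF (K := 1) E3 Em) => t.
by rewrite mul1r; exact: (enorm_y_le (f t - p)).
Qed.

Lemma cvg_triple (T : Type) (F : set_system T) (FF : Filter F)
    (f1 : T -> 'cV[R]_n) (f2 f3 : T -> 'cV[R]_m) a b c :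
  f1 @ F --> a -> f2 @ F --> b -> f3 @ F --> c ->
  (f1 t, f2 t, f3 t) @[t --> F] --> ((a, b, c) : space).
Proof.
move=> fa fb fc.
apply: (@cvg_pair _ _ _ _ _ _ FF (nbhs_filter (a, b)) (nbhs_filter c)) => //.
exact: (@cvg_pair _ _ _ _ _ _ FF (nbhs_filter a) (nbhs_filter b)).
Qed.

Lemma cvg_residual (T : Type) (F : set_system T) (FF : Filter F) (f : T -> space) p :
  f @ F --> p -> residual (f t) @[t --> F] --> residual p.
Proof.
by move=> fp; apply: cvgB; [apply: cvg_mulmx; exact: cvg_x|exact: cvg_z].
Qed.

Hypothesis h_diff : forall x, differentiable (h : 'cV[R]_n -> R^o) x.

Lemma cvg_lag_smooth (T : Type) (F : set_system T) (FF : Filter F) (f : T -> space) p :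
  f @ F --> p -> lag_smooth (f t) @[t --> F] --> lag_smooth p.
Proof.
move=> fp; apply: cvgD; first apply: cvgD.
- have hc : {for p.1.1, continuous h} by apply: differentiable_continuous.
  by apply: continuous_cvg => //; exact: cvg_x.
- by apply: (cvg_ip Em); [exact: cvg_y|exact: cvg_residual].
- apply: cvgM; first exact: cvg_cst.
  under eq_fun do rewrite sqr_enorm; rewrite sqr_enorm.
  by apply: (cvg_ip Em); exact: cvg_residual.
Qed.

Lemma is_gradient_lag_smooth p :
  is_gradient (@dot3 R n m) lag_smooth p (lag_smooth_grad p).
Proof.
have [K K0 KP] := enorm_mulmx_le A.
have hp : is_gradient (@dot3 R n m) (fun q => h q.1.1) p (grad h p.1.1, 0, 0).
  apply: (@is_gradient_comp _ _ _ (@dotv R n) _ (fun q => q.1.1) p (grad h p.1.1) _ En E3) => //.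
  - by move=> q; exact: (enorm_x_le (q - p)).
  - by move=> q; rewrite /dot3 /= !(ip0l Em) !addr0.
  - exact: differentiable_is_gradient.
pose gr : space := (A^T *m (p.2 + r *: residual p), - (p.2 + r *: residual p), residual p).
have -> : lag_smooth_grad p = (grad h p.1.1, 0, 0) + gr.
  by rewrite /lag_smooth_grad /gr; congr (_, _, _); rewrite /= add0r.
have -> : lag_smooth = (fun q => h q.1.1) \+ (fun q => dotv q.2 (residual q)
    + r / 2 * enorm (residual q) ^+ 2).
  by apply/funext => q; rewrite /lag_smooth /= addrA.
apply: (is_gradientD E3 hp).
apply: (is_gradient_quadratic E3 (C := (K + 1) + `|r / 2| * (K + 1) ^+ 2)) => q.
set d := q - p.
have -> : dotv q.2 (residual q) + r / 2 * enorm (residual q) ^+ 2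
  - (dotv p.2 (residual p) + r / 2 * enorm (residual p) ^+ 2) - dot3 gr d =
  dotv d.2 (residual d) + r / 2 * enorm (residual d) ^+ 2.
  have -> : q = p + d by rewrite /d addrC subrK.
  have -> : dot3 gr d = dotv (p.2 + r *: residual p) (residual d) + dotv (residual p) d.2.
    by rewrite /dot3 /gr /= (dotv_mulmx A^T) trmxK (ipNl Em) -(ipBr Em).
  rewrite residualD; move: (residual p) (residual d) => a b.
  rewrite !sqr_enorm /= !(ipDl Em) !(ipDr Em) !(ipZl Em).
  rewrite !(ipNl Em) !(ipNr Em) (euclideanC Em b a) (euclideanC Em a q.2).
  by rewrite (euclideanC Em a p.2); field.
have dl : enorm (residual d) <= (K + 1) * enorm3 d.
  rewrite (le_trans (ipnormD Em _ _))// mulrDl mul1r lerD//.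
    by rewrite (le_trans (KP _))// ler_wpM2l// enorm_x_le.
  by rewrite (ipnormN Em); exact: enorm_z_le.
rewrite (le_trans (ler_normD _ _))// mulrDl lerD//.
  rewrite (le_trans (cauchy_schwarz Em _ _))// mulrC expr2 mulrA.
  apply: ler_pM; rewrite ?ipnorm_ge0//; exact: enorm_y_le.
rewrite normrM -mulrA ler_wpM2l// ger0_norm ?sqr_ge0// -exprMn.
by rewrite ler_pXn2r ?nnegrE ?enorm_ge0 ?mulr_ge0 ?addr_ge0 ?ipnorm_ge0.
Qed.

Lemma lower_tangent_lagrangian p s :
  lower_tangent (@dotv R m) g p.1.2 s ->
  lower_tangent (@dot3 R n m) (aug_lagrangian g h A r) p
    ((0, s, 0) + lag_smooth_grad p).
Proof.
move=> gs; have -> : aug_lagrangian g h A r =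
    (fun q => g q.1.2 + (lag_smooth q)%:E)%E by apply/funext => q; rewrite aug_lagrangianE.
apply: (lower_tangentD E3 _ (is_gradient_lag_smooth p)).
apply: (@lower_tangent_comp _ _ _ (@dotv R m) _ (fun q => q.1.2) p s _ Em E3) => //.
- by move=> q; exact: (enorm_z_le (q - p)).
- by move=> q; rewrite /dot3 /= !(ip0l Em) (ip0l En) addr0 add0r.
Qed.

(** Subtracting the smooth part leaves p |-> g(z), which is constant along the x
    and y slices; there its only subgradient is 0. *)
Lemma lower_tangent_lagrangianE p d : g p.1.2 \is a fin_num ->
  lower_tangent (@dot3 R n m) (aug_lagrangian g h A r) p d ->
  [/\ d.1.1 = grad h p.1.1 + A^T *m (p.2 + r *: residual p),
      lower_tangent (@dotv R m) g p.1.2 (d.1.2 + (p.2 + r *: residual p)) &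
      d.2 = residual p].
Proof.
move=> fg; have -> : aug_lagrangian g h A r =
    (fun q => g q.1.2 + (lag_smooth q)%:E)%E by apply/funext => q; rewrite aug_lagrangianE.
move=> /(lower_tangentB E3)/(_ (is_gradient_lag_smooth p)).
set e := d - _ => ge.
have slice (W : normedModType R) (ip : W -> W -> R) (j : W -> space) w d' :
    euclidean ip -> j w = p ->
    (forall w', enorm3 (j w' - j w) <= ipnorm ip (w' - w)) ->
    (forall w', dot3 e (j w' - j w) = ip d' (w' - w)) ->
    lower_tangent ip (fun w => g (j w).1.2) w d'.
  move=> EW jw j2 j3; rewrite -jw in ge.
  exact: (lower_tangent_comp E3 EW j2 j3 ge).
have cst_grad N (w : 'cV[R]_N) d' :
    lower_tangent (@dotv R N) (fun=> g p.1.2) w d' -> d' = 0.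
  rewrite -(fineK fg) => H; apply: (is_gradient_lower_tangent (euclidean_dotv _ _) _ H).
  apply: (is_gradient_quadratic (euclidean_dotv _ _) (C := 0)) => v.
  by rewrite subrr (ip0l (euclidean_dotv _ _)) subrr normr0 mul0r.
have ex : e.1.1 = 0.
  apply: (cst_grad _ p.1.1).
  apply: (slice _ _ (fun w => (w, p.1.2, p.2)) p.1.1) => // [|w|w].
  - by case: (p) => [[]].
  - by rewrite /enorm3 /ipnorm /dot3 /= !subrr (ip0l Em) !addr0.
  - by rewrite /dot3 /= !subrr !(ip0r Em) !addr0.
have ey : e.2 = 0.
  apply: (cst_grad _ p.2).
  apply: (slice _ _ (fun w => (p.1.1, p.1.2, w)) p.2) => // [|w|w].
  - by case: (p) => [[]].
  - by rewrite /enorm3 /ipnorm /dot3 /= !subrr (ip0l Em) (ip0l En) !add0r.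
  - by rewrite /dot3 /= !subrr (ip0r Em) (ip0r En) !add0r.
have gz : lower_tangent (@dotv R m) g p.1.2 e.1.2.
  apply: (slice _ _ (fun w => (p.1.1, w, p.2)) p.1.2) => // [|w|w].
  - by case: (p) => [[]].
  - by rewrite /enorm3 /ipnorm /dot3 /= !subrr (ip0l Em) (ip0l En) add0r addr0.
  - by rewrite /dot3 /= !subrr (ip0r Em) (ip0r En) add0r addr0.
split.
- by apply/eqP; rewrite -subr_eq0; apply/eqP; exact: ex.
- by move: gz; rewrite /e /= opprK.
- by apply/eqP; rewrite -subr_eq0; apply/eqP; exact: ey.
Qed.

Variable L : R.
Hypothesis h_lip : forall x x', enorm (grad h x - grad h x') <= L * enorm (x - x').
Hypothesis g_gtNy : forall z, (-oo < g z)%E.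

Lemma cvg_grad (T : Type) (F : set_system T) (FF : Filter F)
    (f : T -> 'cV[R]_n) x :
  f @ F --> x -> grad h (f t) @[t --> F] --> grad h x.
Proof. by apply: cvg_ipnorm_le En En _ => t; exact: h_lip. Qed.

Lemma aug_lagrangian_gtNy p : (-oo < aug_lagrangian g h A r p)%E.
Proof.
by rewrite aug_lagrangianE; case: (g _) (g_gtNy p.1.2) => [a||] // _; rewrite -EFinD ltNyr.
Qed.

Lemma aug_lagrangian_fin p :
  (aug_lagrangian g h A r p < +oo)%E -> g p.1.2 \is a fin_num.
Proof. by rewrite aug_lagrangianE; case: (g _) (g_gtNy p.1.2). Qed.

(** The y-part of the subgradients is the residual, so it vanishes in the limit;
    then the x- and z-parts become the two remaining equations. The values of g
    converge because those of the Lagrangian and of its smooth part do. *)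
Lemma crit_lagrangian_sub : crit (@dot3 R n m) (aug_lagrangian g h A r) `<=`
  [set p | [/\ - (A^T *m p.2) = grad h p.1.1,
                limiting_subdiff (@dotv R m) g p.1.2 p.2 &
                p.1.2 = A *m p.1.1]].
Proof.
move=> p [pfin [ps [ds [psp ds0 Lp dP]]]].
have split_dP k : [/\ (ds k).1.1 = grad h (ps k).1.1
        + A^T *m ((ps k).2 + r *: residual (ps k)),
      frechet_subdiff (@dotv R m) g (ps k).1.2
        ((ds k).1.2 + ((ps k).2 + r *: residual (ps k))) &
      (ds k).2 = residual (ps k)].
  have /(frechet_subdiffP E3 _ _ aug_lagrangian_gtNy)[fin tan] := dP k.
  have gfin := aug_lagrangian_fin fin.
  have [dx dz dy'] := lower_tangent_lagrangianE gfin tan; split=> //.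
  by apply/(frechet_subdiffP Em) => //; split=> //; rewrite ltey_eq gfin.
have resp : residual p = 0.
  apply: (cvg_unique _ (cvg_residual _ psp)); first exact: norm_hausdorff.
  rewrite (_ : (fun k => _) = fun k => (ds k).2).
    exact: (cvg_y _ ds0).
  by apply/funext => k; have [] := split_dP k.
have multp : (ps k).2 + r *: residual (ps k) @[k --> \oo] --> p.2.
  rewrite -[X in _ --> X]addr0 -(scaler0 _ r) -resp.
  apply: cvgD; first exact: cvg_y.
  by apply: cvgZl_tmp; exact: cvg_residual.
split.
- apply/eqP; rewrite eq_sym -addr_eq0; apply/eqP.
  have : (ds k).1.1 @[k --> \oo] --> grad h p.1.1 + A^T *m p.2.
    under eq_fun => k do (have [-> _ _] := split_dP k).
    by apply: cvgD; [apply: cvg_grad; exact: cvg_x|exact: cvg_mulmx].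
  move=> H; apply: (cvg_unique _ H); first exact: norm_hausdorff.
  exact: (cvg_x _ ds0).
- have gfin := aug_lagrangian_fin pfin.
  split; first by rewrite ltey_eq gfin.
  exists (fun k => (ps k).1.2), (fun k => (ds k).1.2 + ((ps k).2 + r *: residual (ps k))).
  split.
  + exact: cvg_z.
  + rewrite -[X in _ --> X]add0r; apply: cvgD => //; exact: (cvg_z _ ds0).
  + have gE q : g q.1.2 = (aug_lagrangian g h A r q - (lag_smooth q)%:E)%E.
      by rewrite aug_lagrangianE addeK.
    under eq_fun do rewrite gE; rewrite gE.
    apply: cvgeB => //; first by rewrite fin_num_adde_defl.
    by apply: cvg_EFin; [exact: nearW|exact: cvg_lag_smooth].
  + by move=> k; have [] := split_dP k.
- by apply/eqP; rewrite eq_sym -subr_eq0; apply/eqP.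
Qed.

End Lagrangian.

(** * Convergence of the proximal ADMM *)
Lemma cvg_succ (V : ptopologicalType) (u : nat -> V) (l : V) :
  u k.+1 @[k --> \oo] --> l <-> u @ \oo --> l.
Proof. by rewrite -(cvg_shiftS u). Qed.

Lemma decreasing_gap_cvg (R : realType) (V d : nat -> R) (b : R) :
  (forall k, V k.+1 + d k <= V k) -> (forall k, 0 <= d k) -> (forall k, b <= V k) ->
  cvgn V /\ d @ \oo --> (0 : R).
Proof.
move=> Vd d0 Vb.
have Vc : cvgn V.
  apply: nonincreasing_is_cvgn; last by exists b => _ [k _ <-].
  by apply/nonincreasing_seqP => k; rewrite (le_trans _ (Vd k))// lerDl.
split=> //; apply: (@squeeze_cvgr _ _ _ _ (fun=> 0) (fun k => V k - V k.+1)).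
- by apply: nearW => k; rewrite d0 /= lerBrDl.
- exact: cvg_cst.
- rewrite -[X in _ --> X](subrr (limn V)); apply: cvgB => //.
  exact/(@cvg_succ _ V)/Vc.
Qed.

Lemma cvg0_sqr_enorm (R : realType) N (v : nat -> 'cV[R]_N) (c : R) (d : nat -> R) :
  0 < c -> (forall k, c * enorm (v k) ^+ 2 <= d k) -> d @ \oo --> (0 : R) ->
  v @ \oo --> (0 : 'cV[R]_N).
Proof.
move=> c0 vd d0; apply/(cvg_ipnorm (euclidean_dotv _ _))/cvgr0Pnorm_lt => e e0.
have ce : 0 < c * e ^+ 2 by rewrite mulr_gt0// exprn_gt0.
move/cvgr0Pnorm_lt : d0 => /(_ _ ce); apply: filterS => k dk.
rewrite subr0 ger0_norm ?ipnorm_ge0//.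
rewrite -(@ltr_pXn2r _ 2) ?nnegrE ?ipnorm_ge0 ?(ltW e0)// -(ltr_pM2l c0).
exact: le_lt_trans (vd k) (le_lt_trans (ler_norm _) dk).
Qed.

Section ADMM.
Variables (R : realType) (n m : nat).
Variables (g : 'cV[R]_m -> \bar R) (h : 'cV[R]_n -> R) (A : 'M[R]_(m, n)) (L : R).
Hypothesis g_gtNy : forall z, (-oo < g z)%E.
Hypothesis g_proper : exists z, (g z < +oo)%E.
Hypothesis h_diff : forall x, differentiable (h : 'cV[R]_n -> R^o) x.
Hypothesis h_lip : forall x x', enorm (grad h x - grad h x') <= L * enorm (x - x').
Variables (M1 : nat -> 'M[R]_n) (M2 : nat -> 'M[R]_m).
Hypothesis M1_psd : forall k, sym_psd (M1 k).
Hypothesis M2_psd : forall k, sym_psd (M2 k).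
Variables (alg : algorithm) (r rho : R).
Hypothesis hA : assumption_A g h A alg M1 M2 r rho L.
Variables (x : nat -> 'cV[R]_n) (z y : nat -> 'cV[R]_m).
Hypothesis xzy_generated : generated g h A alg M1 M2 r rho x z y.

Let En := @euclidean_dotv R n.
Let Em := @euclidean_dotv R m.

Let mu1 := sup (range (fun k => opnorm (M1 k))).
Let mu2 := sup (range (fun k => opnorm (M2 k))).
Let lam := lambda_min (A *m A^T).

Let r0 : 0 < r. Proof. exact: A_r_gt0 hA. Qed.
Let rhoP : 0 < rho < 2. Proof. exact: A_rho hA. Qed.
Let rho0 : 0 < rho. Proof. by case/andP: rhoP. Qed.
Let mu10 : 0 <= mu1. Proof. exact: A_mu1_ge0 hA. Qed.

Lemma enorm_M1_le k u : enorm (M1 k *m u) <= mu1 * enorm u.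
Proof.
rewrite (le_trans (opnormP _ _))// ler_wpM2r ?enorm_ge0//.
by apply: ub_le_sup; [exact: A_M1_bounded hA|exists k].
Qed.

Lemma enorm_M2_le k u : enorm (M2 k *m u) <= mu2 * enorm u.
Proof.
rewrite (le_trans (opnormP _ _))// ler_wpM2r ?enorm_ge0//.
by apply: ub_le_sup; [exact: A_M2_bounded hA|exists k].
Qed.

(** In dimension 0 there is no eigenvalue, so [lambda_min] is the infimum of the
    empty set and T0 = 0, against 0 < 4 T0 L. *)
Lemma constraint_dim_gt0 : (0 < m)%N.
Proof.
have /andP[T0L _] := A_r_ge hA; rewrite lt0n; apply: contraTneq T0L => m0.
suff -> : T0 A rho = 0 by rewrite mulr0 mul0r ltxx.
have lam0 : lambda_min (A *m A^T) = 0.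
  rewrite /lambda_min [X in inf X](_ : _ = set0) ?inf0//.
  apply/seteqP; split=> // a /eigenvalueP[v _ /negP[]].
  by apply/eqP/rowP => -[i im]; exfalso; move: im; rewrite m0.
by rewrite /T0 lam0 !mul0r invr0 !mulr0 if_same.
Qed.

Lemma lam_gt0 : 0 < lam.
Proof.
by have [] := lambda_min_surjective constraint_dim_gt0 (A_surjective hA).
Qed.

Lemma T0_gt0 : 0 < T0 A rho.
Proof.
have l0 := lam_gt0; rewrite /T0; case: ifPn => _.
  by rewrite divr_gt0// mulr_gt0.
have rho2 : 0 < 2 - rho by rewrite subr_gt0; case/andP: rhoP.
by rewrite divr_gt0// mulr_gt0// exprn_gt0.
Qed.

Lemma L_gt0 : 0 < L.
Proof.
have /andP[+ _] := A_r_ge hA.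
by rewrite pmulr_rgt0// mulr_gt0// T0_gt0.
Qed.

Let sg := L + mu1.
Let sg_gt0 : 0 < sg. Proof. by rewrite ltr_pwDl// L_gt0. Qed.

(** The gradient of h in the optimality condition of the x-step; through it both
    algorithms are treated at once. *)
Let dh k := match alg with
  | Algorithm1 => grad h (x k.+1) | Algorithm2 => grad h (x k) end.

Let dx k := x k.+1 - x k.
Let dy k := y k.+1 - y k.
Let dz k := z k.+1 - z k.

Lemma x_step_optimality k :
  dh k + penalized_grad A r (M1 k) (y k) (z k.+1) (x k) (x k.+1) = 0.
Proof.
have [_ xmin _] := xzy_generated k; have [MT _] := M1_psd k.
have hq := is_gradient_penalized A r (y k) (z k.+1) (x k) (x k.+1) MT.
have objE : x_objective h A alg r (M1 k) (x k) (z k.+1) (y k) =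
  (match alg with Algorithm1 => h
    | Algorithm2 => fun v => dotv (v - x k) (grad h (x k)) end) \+
  penalized A r (M1 k) (y k) (z k.+1) (x k).
  by apply/funext => v; rewrite /x_objective /penalized /=; case: (alg); rewrite !addrA.
rewrite objE in xmin; apply: (argmin_is_gradient En xmin).
apply: (is_gradientD En _ hq).
rewrite /dh; case: (alg); first exact: differentiable_is_gradient.
apply: (is_gradient_quadratic En (C := 0)) => v; rewrite mul0r normr_le0.
rewrite (euclideanC En (grad h _)) !(ipBl En).
by apply/eqP; ring.
Qed.

Lemma x_step_increment k :
  h (x k.+1) - h (x k) <= dotv (dh k) (dx k) + L / 2 * enorm (dx k) ^+ 2.
Proof.
have -> : x k.+1 = x k + dx k by rewrite /dx addrC subrK.
rewrite /dh; case: (alg); last exact: descent_lemma.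
have -> : x k.+1 = x k + dx k by rewrite /dx addrC subrK.
exact: descent_lemma_end.
Qed.

Let w k := - dh k - M1 k *m dx k.

Lemma dual_stepE k : y k.+1 = y k + (rho * r) *: (A *m x k.+1 - z k.+1).
Proof. by have [] := xzy_generated k. Qed.

(** The multiplier update read backwards. *)
Lemma residualE k : A *m x k.+1 - z k.+1 = (rho * r)^-1 *: dy k.
Proof.
rewrite /dy dual_stepE [y k + _]addrC addrK scalerA mulVf ?scale1r//.
by rewrite gt_eqF// mulr_gt0.
Qed.

(** The optimality condition says w_k = A^T (y_k + r (A x_(k+1) - z_(k+1))),
    while y_(k+1) moves from y_k by rho times that correction. *)
Lemma dual_recursion k :
  A^T *m y k.+1 = (1 - rho) *: (A^T *m y k) + rho *: w k.
Proof.
have wE : w k = A^T *m y k + r *: (A^T *m (A *m x k.+1 - z k.+1)).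
  have := x_step_optimality k; rewrite /penalized_grad /w /dx.
  move: (A *m x k.+1 - z k.+1) (M1 k *m _) => b c.
  rewrite mulmxDr -scalemxAr addrA => /eqP; rewrite addr_eq0 => /eqP <-.
  by rewrite addKr.
rewrite wE dual_stepE; move: (A *m x k.+1 - z k.+1) => b.
rewrite mulmxDr -scalemxAr scalerDr scalerBl scale1r scalerA addrA.
by rewrite subrK.
Qed.

(** Coefficients of |dx_(k+1)|^2 and |dx_k|^2 in the bound of the increment of
    w. In Algorithm 1 the weights of Young's inequality are 3/2 and 3 instead of
    2 and 2: this leaves a positive margin in [lyapunov_decrease] even when the
    proximal matrices M1 vanish. *)
Let al : R := match alg with Algorithm1 => 3 / 2 * sg ^+ 2
  | Algorithm2 => 2 * mu1 ^+ 2 end.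
Let be : R := match alg with Algorithm1 => 3 * mu1 ^+ 2
  | Algorithm2 => 2 * sg ^+ 2 end.

Lemma w_increment k : enorm (w k.+1 - w k) ^+ 2 <=
  al * enorm (dx k.+1) ^+ 2 + be * enorm (dx k) ^+ 2.
Proof.
pose a := enorm (dx k.+1); pose b := enorm (dx k).
have a0 : 0 <= a by exact: enorm_ge0.
have b0 : 0 <= b by exact: enorm_ge0.
pose c := match alg with Algorithm1 => a | Algorithm2 => b end.
have dle : enorm (dh k - dh k.+1) <= L * c.
  by rewrite /enorm (ipnormB En) -/(enorm _) /dh /c; case: (alg); exact: h_lip.
have wle : enorm (w k.+1 - w k) <= L * c + mu1 * a + mu1 * b.
  have -> : w k.+1 - w k = (dh k - dh k.+1) + - (M1 k.+1 *m dx k.+1) + M1 k *m dx k.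
    by rewrite /w opprD !opprK addrACA addrA [dh k - dh k.+1]addrC.
  rewrite (le_trans (ipnormD En _ _))// lerD ?enorm_M1_le//.
  rewrite (le_trans (ipnormD En _ _))// lerD// (ipnormN En); exact: enorm_M1_le.
have w0 := enorm_ge0 (w k.+1 - w k).
have : enorm (w k.+1 - w k) ^+ 2 <= (L * c + mu1 * a + mu1 * b) ^+ 2.
  by rewrite ler_pXn2r ?nnegrE// (le_trans w0).
move/le_trans; apply; rewrite /al /be /c -/a -/b; case: (alg).
- have -> : L * a + mu1 * a + mu1 * b = sg * a + mu1 * b by rewrite /sg; ring.
  have := sqr_ge0 (sg * a - 2 * (mu1 * b)); nra.
- have -> : L * b + mu1 * a + mu1 * b = mu1 * a + sg * b by rewrite /sg; ring.
  have := sqr_ge0 (mu1 * a - sg * b); nra.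
Qed.

Lemma z_step_finite k : g (z k.+1) \is a fin_num.
Proof.
have [zmin _ _] := xzy_generated k; have [z' z'P] := g_proper.
have := zmin z'; rewrite /z_objective fin_numE gt_eqF//=.
by case: (g z') (g_gtNy z') z'P => [a||] //; case: (g _).
Qed.

Let lag k := fine (g (z k)) + lag_smooth h A r (x k, z k, y k).

Let kappa := CM A alg rho L mu1 / r.

(** The index starts at 1, where g is finite at the iterates. *)
Lemma lagrangian_step k :
  lag k.+2 + kappa / 2 * enorm (dx k.+1) ^+ 2 <=
  lag k.+1 + enorm (dy k.+1) ^+ 2 / (rho * r).
Proof.
have [zmin _ _] := xzy_generated k.+1; have [MT1 _] := M1_psd k.+1.
have [_ M2pos] := M2_psd k.+1.
have xdec := x_step_decrease MT1 (x_step_optimality k.+1) (x_step_increment k.+1)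
  (A_M1_ge hA k.+1).
have zdec := zmin (z k.+1).
have fz1 := z_step_finite k; have fz2 := z_step_finite k.+1.
rewrite /z_objective -(fineK fz1) -(fineK fz2) -!EFinD lee_fin in zdec.
rewrite subrr /sqnorm_mx mulmx0 (ip0r Em) mulr0 addr0 in zdec.
have := M2pos (z k.+2 - z k.+1); rewrite /sqnorm_mx mul0mx (ip0l Em) => M20.
rewrite /lag /lag_smooth /=.
have dyE : dotv (y k.+2) (A *m x k.+2 - z k.+2) =
  dotv (y k.+1) (A *m x k.+2 - z k.+2) + enorm (dy k.+1) ^+ 2 / (rho * r).
  have -> : y k.+2 = y k.+1 + dy k.+1 by rewrite /dy addrC subrK.
  by rewrite (ipDl Em) [in dotv (dy _) _]residualE (ipZr Em) -sqr_enorm; ring.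
rewrite dyE -/kappa in xdec *; lra.
Qed.

Let T1 := dual_T1 lam rho.

Let E k := enorm (A^T *m dy k) ^+ 2.

Lemma dual_increment_step k : enorm (dy k.+1) ^+ 2 / rho <=
  T1 * (E k - E k.+1)
  + T0 A rho * (al * enorm (dx k.+1) ^+ 2 + be * enorm (dx k) ^+ 2).
Proof.
have [_ lamP] := lambda_min_surjective constraint_dim_gt0 (A_surjective hA).
have rec : A^T *m dy k.+1 = (1 - rho) *: (A^T *m dy k) + rho *: (w k.+1 - w k).
  by rewrite /dy !mulmxBr !dual_recursion opprD addrACA -!scalerBr.
have := dual_step lam_gt0 rhoP (lamP (dy k.+1)) rec.
move/le_trans; apply; rewrite lerD2l//.
by rewrite ler_wpM2l ?w_increment// ltW// T0_gt0.
Qed.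

(** The dual inequality is used with weight 1 + eps, so that a fraction of
    |dy|^2 remains on the decreasing side. The value 1 / 18 is small enough for
    the margin left by [al] and [be]: it multiplies al + be, which is at most
    9/2 sg^2 for both algorithms, and so costs at most sg^2 / 4. *)
Let eps : R := 1 / 18.

Let V k := lag k.+1 + (1 + eps) / r * (T1 * E k + T0 A rho * be * enorm (dx k) ^+ 2).

Lemma lyapunov_decrease : exists2 c, 0 < c & forall k,
  V k.+1 + c * (enorm (dy k.+1) ^+ 2 + enorm (dx k.+1) ^+ 2) <= V k.
Proof.
pose c1 := eps / (rho * r); pose c2 := T0 A rho / r * (sg ^+ 2 / 4).
have T00 := T0_gt0.
have c10 : 0 < c1 by rewrite divr_gt0 ?mulr_gt0// /eps; lra.
have c20 : 0 < c2 by rewrite mulr_gt0 ?divr_gt0// exprn_gt0.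
(* Half of CM / T0, the amount provided by the Loewner bound, covers al + be with
   a margin of sg^2 / 4. *)
have budget : (1 + eps) * (al + be) + sg ^+ 2 / 4 <=
    CM A alg rho L mu1 / T0 A rho / 2.
  have L0 := L_gt0.
  have mus : mu1 ^+ 2 <= sg ^+ 2 by rewrite ler_pXn2r ?nnegrE ?(ltW sg_gt0)// lerDr ltW.
  rewrite /al /be /CM /eps -/sg; case: (alg); rewrite mulfK ?gt_eqF//;
    move: (sg ^+ 2) (mu1 ^+ 2) mus (sqr_ge0 sg) => s u us s0; lra.
exists (Num.min c1 c2) => [|k]; first by rewrite lt_min c10.
have c1m : Num.min c1 c2 <= c1 by rewrite ge_min lexx.
have c2m : Num.min c1 c2 <= c2 by rewrite ge_min lexx orbT.
move: (Num.min _ _) c1m c2m => c c1m c2m.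
have := lagrangian_step k; have := dual_increment_step k.
have := sqr_ge0 (enorm (dy k.+1)); have := sqr_ge0 (enorm (dx k.+1)).
rewrite /V; move: (lag _) (lag _) (E _) (E _) => l2 l1 e1 e0.
move: (enorm (dy _) ^+ 2) (enorm (dx k) ^+ 2) (enorm (dx k.+1) ^+ 2).
move=> d a b b0 d0 De Lg.
have kE : kappa / 2 = (T0 A rho / r) * (CM A alg rho L mu1 / T0 A rho / 2).
  by rewrite /kappa; field; rewrite !gt_eqF.
have T0r0 : 0 < T0 A rho / r by rewrite divr_gt0.
have De' : (1 + eps) / r * (d / rho) <= (1 + eps) / r *
   (T1 * (e0 - e1) + T0 A rho * (al * b + be * a)).
  by rewrite ler_wpM2l// divr_ge0 ?ltW// /eps; lra.
have Bu := ler_wpM2r b0 (ler_wpM2l (ltW T0r0) budget).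
rewrite -kE in Bu.
have S : c * (d + b) <= c1 * d + c2 * b.
  by rewrite mulrDr lerD// ler_wpM2r.
have D1 : d / (rho * r) + c1 * d = (1 + eps) / r * (d / rho).
  by rewrite /c1; field; rewrite !gt_eqF.
have D2 : T0 A rho / r * ((1 + eps) * (al + be) + sg ^+ 2 / 4) * b =
  (1 + eps) / r * (T0 A rho * (al * b + be * b)) + c2 * b.
  by rewrite /c2; field; rewrite !gt_eqF.
lra.
Qed.

Hypothesis xzy_bounded : exists C : R, forall k, enorm3 (x k, z k, y k) <= C.

Let u k := (x k, z k, y k).

Lemma components_bounded : exists2 C, 0 <= C & forall k,
  [/\ enorm (x k) <= C, enorm (z k) <= C & enorm (y k) <= C].
Proof.
have [C CP] := xzy_bounded; exists C => [|k].
  by rewrite (le_trans _ (CP 0%N))// ipnorm_ge0.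
split; apply: le_trans (CP k); first exact: (enorm_x_le (u k)).
- exact: (enorm_z_le (u k)).
- exact: (enorm_y_le (u k)).
Qed.

Lemma residual_bounded : exists2 C, 0 <= C & forall j k,
  enorm (A *m x j - z k) <= C.
Proof.
have [C C0 CP] := components_bounded; have [K K0 KP] := enorm_mulmx_le A.
exists (K * C + C) => [|j k]; first by rewrite addr_ge0 ?mulr_ge0.
have [xC _ _] := CP j; have [_ zC _] := CP k.
rewrite (le_trans (ipnormD Em _ _))// lerD ?(ipnormN Em)//.
by rewrite (le_trans (KP _))// ler_wpM2l.
Qed.

Lemma lyapunov_bounded_below : exists b, forall k, b <= V k.
Proof.
have [C C0 CP] := components_bounded; have [D D0 DP] := residual_bounded.
have [cg cgP] := A_g_bounded_below hA; have [ch chP] := A_h_bounded_below hA.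
exists (cg + ch - C * D) => k; have [_ _ yC] := CP k.+1.
have gk : cg <= fine (g (z k.+1)) by rewrite -lee_fin fineK ?z_step_finite.
have yres : - (C * D) <= dotv (y k.+1) (A *m x k.+1 - z k.+1).
  rewrite lerNl (le_trans (ler_norm _))// normrN.
  rewrite (le_trans (cauchy_schwarz Em _ _))//.
  by apply: ler_pM; rewrite ?ipnorm_ge0 ?DP.
have sq : 0 <= r / 2 * enorm (A *m x k.+1 - z k.+1) ^+ 2.
  by rewrite mulr_ge0 ?sqr_ge0 ?divr_ge0 ?ltW.
have Vr : 0 <= (1 + eps) / r * (T1 * E k + T0 A rho * be * enorm (dx k) ^+ 2).
  have be0 : 0 <= be by rewrite /be; case: (alg); rewrite mulr_ge0 ?sqr_ge0.
  have eps0 : 0 <= 1 + eps by rewrite /eps; lra.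
  apply: mulr_ge0; first exact: divr_ge0 eps0 (ltW r0).
  apply: addr_ge0; apply: mulr_ge0 (sqr_ge0 _).
    exact: dual_T1_ge0 lam_gt0 rhoP.
  exact: mulr_ge0 (ltW T0_gt0) be0.
rewrite /V ler_wpDr// /lag /lag_smooth /residual /=; have := chP (x k.+1); lra.
Qed.

Lemma increments_cvg : [/\ cvgn V, dx @ \oo --> (0 : 'cV[R]_n) &
  dy @ \oo --> (0 : 'cV[R]_m)].
Proof.
have [c c0 cP] := lyapunov_decrease; have [b bP] := lyapunov_bounded_below.
have [|Vc d0] := decreasing_gap_cvg cP _ bP.
  by move=> k; rewrite mulr_ge0 ?addr_ge0 ?sqr_ge0 ?ltW.
split=> //.
- apply/(@cvg_succ _ dx); apply: (cvg0_sqr_enorm c0 _ d0) => k /=.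
  by apply: ler_wpM2l (ltW c0) _ _ _; rewrite lerDr sqr_ge0.
- apply/(@cvg_succ _ dy); apply: (cvg0_sqr_enorm c0 _ d0) => k /=.
  by apply: ler_wpM2l (ltW c0) _ _ _; rewrite lerDl sqr_ge0.
Qed.

Lemma dx_cvg : dx @ \oo --> (0 : 'cV[R]_n). Proof. by have [] := increments_cvg. Qed.
Lemma dy_cvg : dy @ \oo --> (0 : 'cV[R]_m). Proof. by have [] := increments_cvg. Qed.

Lemma residual_cvg : A *m x k - z k @[k --> \oo] --> (0 : 'cV[R]_m).
Proof.
apply/(@cvg_succ _ (fun k => A *m x k - z k)).
rewrite (_ : (fun k => _) = fun k => (rho * r)^-1 *: dy k); last first.
  by apply/funext => k; exact: residualE.
rewrite -(scaler0 _ (rho * r)^-1).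
by apply: cvgZ; [exact: cvg_cst|exact: dy_cvg].
Qed.

(** z = A x - (A x - z), and both terms have vanishing increments. *)
Lemma dz_cvg : dz @ \oo --> (0 : 'cV[R]_m).
Proof.
pose res k := A *m x k - z k.
have dzE k : dz k = A *m dx k - (res k.+1 - res k).
  by rewrite /dz /dx /res mulmxBr; apply/matrixP => i j; rewrite !mxE; ring.
rewrite (_ : dz = fun k => A *m dx k - (res k.+1 - res k)); last exact/funext.
have -> : (0 : 'cV[R]_m) = A *m 0 - (0 - 0) by rewrite mulmx0 !subr0.
apply: cvgB; first by apply: cvg_mulmx; exact: dx_cvg.
apply: cvgB; last exact: residual_cvg.
exact/(@cvg_succ _ (fun k => A *m x k - z k))/residual_cvg.
Qed.

(** The Lyapunov function converges and differs from the Lagrangian by terms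
    that tend to 0. *)
Lemma lag_cvg : cvgn lag.
Proof.
have [Vc _ _] := increments_cvg.
have sq0 N (v : nat -> 'cV[R]_N) : v @ \oo --> (0 : 'cV[R]_N) ->
    enorm (v k) ^+ 2 @[k --> \oo] --> (0 : R).
  move=> v0; under eq_fun do rewrite sqr_enorm.
  by rewrite -(ip0l (euclidean_dotv R N) 0); apply: (cvg_ip (euclidean_dotv R N)).
have lagE k : lag k.+1 = V k
    - (1 + eps) / r * (T1 * E k + T0 A rho * be * enorm (dx k) ^+ 2).
  by rewrite /V addrK.
apply/cvg_ex; exists (limn V - (1 + eps) / r * (T1 * 0 + T0 A rho * be * 0)).
apply/(@cvg_succ _ lag); rewrite (_ : (fun k => lag k.+1) = fun k => V k
    - (1 + eps) / r * (T1 * E k + T0 A rho * be * enorm (dx k) ^+ 2)); last exact/funext.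
apply: cvgB => //; apply: cvgM; first exact: cvg_cst.
apply: cvgD; apply: cvgM; try exact: cvg_cst.
- by apply: sq0; rewrite -(mulmx0 _ A^T); apply: cvg_mulmx; exact: dy_cvg.
- by apply: sq0; exact: dx_cvg.
Qed.

Let Lr := aug_lagrangian g h A r.

Lemma LrE k : Lr (u k.+1) = (lag k.+1)%:E.
Proof. by rewrite /Lr aug_lagrangianE /= -(fineK (z_step_finite k)). Qed.

Lemma Lr_cvg : Lr (u k) @[k --> \oo] --> (limn lag)%:E.
Proof.
apply/(@cvg_succ _ (fun k => Lr (u k))).
rewrite (_ : (fun k => _) = fun k => (lag k.+1)%:E); last first.
  by apply/funext => k; exact: LrE.
apply: cvg_EFin; first exact: nearW.
exact/(@cvg_succ _ lag)/lag_cvg.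
Qed.

(** Minus the gradient at z_(k+1) of the quadratic part of the z-step, hence a
    Frechet subgradient of g there. *)
Let s k : 'cV[R]_m := y k + r *: (A *m x k - z k.+1) - M2 k *m dz k.

Lemma z_objectiveE k v : z_objective g A r (M2 k) (x k) (z k) (y k) v =
  (g v + (penalized (- 1%:M) r (M2 k) (y k) (- (A *m x k)) (z k) v)%:E)%E.
Proof.
rewrite /z_objective /penalized mulNmx mul1mx.
by rewrite (_ : - v - - (A *m x k) = A *m x k - v)// opprK addrC.
Qed.

Lemma z_step_grad k : penalized_grad (- 1%:M) r (M2 k) (y k) (- (A *m x k)) (z k) (z k.+1)
  = - s k.
Proof.
rewrite /penalized_grad /s mulNmx mul1mx linearN /= trmx1 mulNmx mul1mx opprB.
by rewrite (_ : - z k.+1 - - (A *m x k) = A *m x k - z k.+1) 1?addrC// opprK addrC.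
Qed.

Lemma z_step_lower_tangent k : lower_tangent (@dotv R m) g (z k.+1) (s k).
Proof.
have [zmin _ _] := xzy_generated k; have [MT _] := M2_psd k.
have : argmin (fun v => g v + (penalized (- 1%:M) r (M2 k) (y k)
    (- (A *m x k)) (z k) v)%:E)%E (z k.+1).
  by move=> v; rewrite -!z_objectiveE; exact: zmin.
move=> /(argmin_lower_tangent Em)/(lower_tangentB Em).
move=> /(_ _ (is_gradient_penalized _ _ _ _ _ _ MT)).
by rewrite z_step_grad sub0r opprK.
Qed.

(** Minimality of z_(k+1), with the quadratic part expanded around it: the linear
    and quadratic coefficients are bounded uniformly in k, since the iterates and
    the matrices M2 are. *)
Lemma z_step_bound : exists K, forall k v, (g (z k.+1) <=
  g v + (K * (enorm (v - z k.+1) + enorm (v - z k.+1) ^+ 2))%:E)%E.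
Proof.
have [C C0 CP] := components_bounded; have [D D0 DP] := residual_bounded.
exists (C + r * D + `|mu2| * (C + C) + (r / 2 + `|mu2| / 2)) => k v.
have [zmin _ _] := xzy_generated k; have [MT _] := M2_psd k.
have M2le a : enorm (M2 k *m a) <= `|mu2| * enorm a.
  by rewrite (le_trans (enorm_M2_le _ _))// ler_wpM2r ?enorm_ge0 ?ler_norm.
have sle : enorm (s k) <= C + r * D + `|mu2| * (C + C).
  have [_ zC yC] := CP k; have [_ zC' _] := CP k.+1.
  rewrite (le_trans (ipnormD Em _ _))// (ipnormN Em) lerD//.
    rewrite (le_trans (ipnormD Em _ _))// lerD// (ipnormZ Em) gtr0_norm//.
    by apply: ler_wpM2l (ltW r0) _ _ _; exact: DP.
  apply: le_trans (M2le _) _; apply: ler_wpM2l => //.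
  by rewrite (le_trans (ipnormD Em _ _))// lerD// (ipnormN Em).
have := penalized_expand (- 1%:M) r (y k) (- (A *m x k)) (z k) (z k.+1) v MT.
rewrite z_step_grad mulNmx mul1mx => ex.
have := zmin v; rewrite !z_objectiveE -(fineK (z_step_finite k)).
case: (g v) (g_gtNy v) => [b||] // _; last by move=> _; rewrite addye// leey.
rewrite -!EFinD !lee_fin => H.
have n0 := enorm_ge0 (v - z k.+1).
have lin : dotv (- s k) (v - z k.+1) <= (C + r * D + `|mu2| * (C + C)) * enorm (v - z k.+1).
  rewrite (le_trans (ip_le Em _ _))// (ipnormN Em).
  exact: ler_wpM2r n0 _ _ sle.
have quad : 2^-1 * sqnorm_mx (M2 k) (v - z k.+1) <= `|mu2| / 2 * enorm (v - z k.+1) ^+ 2.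
  have /ler_normlP[_] := sqnorm_mx_le (v - z k.+1) M2le => H2; lra.
have n2 := sqr_ge0 (enorm (v - z k.+1)).
have ne : enorm (- (v - z k.+1)) = enorm (v - z k.+1) by rewrite /enorm (ipnormN Em).
rewrite ne in ex.
have c10 : 0 <= C + r * D + `|mu2| * (C + C).
  by rewrite !addr_ge0 ?mulr_ge0 ?addr_ge0 ?(ltW r0).
have c20 : 0 <= r / 2 + `|mu2| / 2 by rewrite addr_ge0 ?divr_ge0 ?(ltW r0).
move: (C + r * D + `|mu2| * (C + C)) c10 lin => c1 c10 lin.
have p1 := mulr_ge0 c10 n2; have p2 := mulr_ge0 c20 n0.
move: H ex lin quad n0 n2 p1 p2.
move: (penalized _ _ _ _ _ _ _) (penalized _ _ _ _ _ _ _) (dotv _ _) (sqnorm_mx _ _).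
move: (enorm _ ^+ 2) => e2; move: (enorm _) `|mu2| => e1 mm P1 P2 d1 d2 *; nra.
Qed.

Section LimitPoint.
Variables (phi : nat -> nat) (p : 'cV[R]_n * 'cV[R]_m * 'cV[R]_m).
Hypotheses (phi_ge : forall q, (q <= phi q)%N).
Hypothesis up : u (phi q) @[q --> \oo] --> p.

Let phi_oo : phi @ \oo --> \oo.
Proof.
move=> B [N _ NB]; exists N => // q /= Nq; apply: NB => /=.
exact: leq_trans Nq (phi_ge q).
Qed.

Lemma limit_residual : residual A p = 0.
Proof.
apply: (cvg_unique _ (cvg_residual (A := A) _ up)); first exact: norm_hausdorff.
exact: (cvg_comp _ _ phi_oo residual_cvg).
Qed.

Hypothesis g_lsc : lower_semicontinuous g.

(** The limit of g(z) along the subsequence, as dictated by the convergence of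
    the Lagrangian and of its smooth part. *)
Let gam := limn lag - lag_smooth h A r p.

Lemma g_subsequence_cvg : fine (g (z (phi q))) @[q --> \oo] --> gam.
Proof.
rewrite (_ : (fun q => _) = fun q => lag (phi q) - lag_smooth h A r (u (phi q))).
  have H := cvg_lag_smooth (A := A) (r := r) h_diff _ up.
  apply: cvgB; last exact: H.
  exact: (cvg_comp _ _ phi_oo lag_cvg).
by apply/funext => q; rewrite /lag /= addrK.
Qed.

Let near_succ : \forall q \near \oo, exists k, phi q = k.+1.
Proof.
exists 1%N => // q /= q1; exists (phi q).-1; rewrite prednK//.
exact: leq_trans q1 (phi_ge q).
Qed.

(** Lower semicontinuity; it also shows that g is finite at the limit. *)
Lemma g_limit_le : (g p.1.2 <= gam%:E)%E.
Proof.
rewrite leNgt; apply/negP => gamlt.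
have [a gama ag] : exists2 a : R, gam < a & (a%:E < g p.1.2)%E.
  case: (g p.1.2) gamlt => [b||] //; last by exists (gam + 1); rewrite ?ltrDl ?ltry.
  by rewrite lte_fin => gb; exists ((gam + b) / 2); rewrite ?lte_fin; lra.
have [B pB Ba] := g_lsc ag.
suff : a <= gam by rewrite leNgt gama.
apply: (cvgr_to_ge g_subsequence_cvg).
have zB : \forall q \near \oo, B (z (phi q)) := cvg_z _ up pB.
near=> q; have [k kE] : exists k, phi q = k.+1
  by near: q; exact: near_succ.
have : B (z (phi q)) by near: q; exact: zB.
by rewrite kE => /Ba/ltW; rewrite -(fineK (z_step_finite k)) lee_fin.
Unshelve. all: by end_near. Qed.

(** The other inequality: test the minimality of z_(k+1) against the limit. *)
Lemma g_limit : g p.1.2 = gam%:E.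
Proof.
apply/le_anti; rewrite g_limit_le /=.
have := g_limit_le; case gp : (g p.1.2) (g_gtNy p.1.2) => [b||] // _ _.
have [K KP] := z_step_bound.
pose e q := enorm (p.1.2 - z (phi q)).
have e0 : e q @[q --> \oo] --> (0 : R).
  have zc : z (phi q) @[q --> \oo] --> p.1.2 by exact: (cvg_z _ up).
  rewrite (_ : e = fun q => enorm (z (phi q) - p.1.2)); first exact/(cvg_ipnorm Em).
  by apply/funext => q; exact: (ipnormB Em).
have lim0 : b + K * (e q + e q * e q) @[q --> \oo] --> b + K * (0 + 0 * 0).
  apply: cvgD; [exact: cvg_cst|apply: cvgM; first exact: cvg_cst].
  by apply: cvgD => //; exact: cvgM.
rewrite mulr0 addr0 mulr0 addr0 in lim0.
rewrite lee_fin; apply: ler_cvg_to g_subsequence_cvg lim0 _.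
near=> q; have [k kE] : exists k, phi q = k.+1
  by near: q; exact: near_succ.
have := KP k p.1.2.
by rewrite gp -EFinD -(fineK (z_step_finite k)) lee_fin /e kE expr2.
Unshelve. all: by end_near. Qed.

Lemma Lr_limit : Lr p = (limn lag)%:E.
Proof. by rewrite /Lr aug_lagrangianE g_limit -EFinD subrK. Qed.

End LimitPoint.

Let D k := ((0, s k, 0) + lag_smooth_grad h A r (u k.+1) :
  'cV[R]_n * 'cV[R]_m * 'cV[R]_m).

Lemma D_frechet k : frechet_subdiff (@dot3 R n m) Lr (u k.+1) (D k).
Proof.
apply/(frechet_subdiffP (@euclidean_dot3 R n m)).
  by move=> q; exact: aug_lagrangian_gtNy.
rewrite LrE ltry; split=> //.
exact: (lower_tangent_lagrangian A r h_diff (p := u k.+1) (z_step_lower_tangent k)).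
Qed.

(** The optimality conditions rewrite these subgradients in terms of the
    increments, the residual and grad h (x_(k+1)) - dh k, all of which vanish in
    the limit. *)
Lemma D_cvg : D @ \oo --> (0 : 'cV[R]_n * 'cV[R]_m * 'cV[R]_m).
Proof.
have -> : D = fun k => ((grad h (x k.+1) - dh k) + A^T *m dy k - M1 k *m dx k,
    - dy k - r *: (A *m dx k) - M2 k *m dz k, A *m x k.+1 - z k.+1).
  apply/funext => k; rewrite /D /lag_smooth_grad /residual /=; congr (_, _, _); rewrite /= ?add0r//.
  - have := x_step_optimality k; rewrite /penalized_grad -/(dx k).
    have -> : y k.+1 = y k + dy k by rewrite /dy addrC subrK.
    have -> : y k + dy k + r *: (A *m x k.+1 - z k.+1) =
      (y k + r *: (A *m x k.+1 - z k.+1)) + dy k by rewrite addrAC.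
    rewrite (mulmxDr A^T _ (dy k)).
    move: (A^T *m (y k + r *: _)) (M1 k *m dx k) (A^T *m dy k) => a1 a2 a3 opt.
    apply/matrixP => i j; have := congr1 (fun B : 'cV[R]_n => B i j) opt.
    by rewrite !mxE => opt_ij; lra.
  - rewrite /s /dy /dx (mulmxBr A); move: (M2 k *m _) (A *m x k) (A *m x k.+1) => a1 a2 a3.
    by apply/matrixP => i j; rewrite !mxE; ring.
have M1dx : M1 k *m dx k @[k --> \oo] --> (0 : 'cV[R]_n).
  apply: cvg_ipnorm_le En En _ dx_cvg => k.
  by rewrite !subr0; exact: enorm_M1_le.
have M2dz : M2 k *m dz k @[k --> \oo] --> (0 : 'cV[R]_m).
  apply: cvg_ipnorm_le Em Em _ dz_cvg => k.
  by rewrite !subr0; exact: enorm_M2_le.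
have gradd : grad h (x k.+1) - dh k @[k --> \oo] --> (0 : 'cV[R]_n).
  apply: (cvg_ipnorm_le _ (K := L)) En En _ dx_cvg => k; rewrite !subr0 /dh.
  case: (alg); last exact: h_lip.
  by rewrite subrr (ipnorm0 En) mulr_ge0 ?ipnorm_ge0 ?(ltW L_gt0).
apply: cvg_triple.
- have -> : (0 : 'cV[R]_n) = 0 + A^T *m 0 - 0 by rewrite mulmx0 addr0 subr0.
  by apply: cvgB => //; apply: cvgD => //; apply: cvg_mulmx; exact: dy_cvg.
- have -> : (0 : 'cV[R]_m) = - 0 - r *: (A *m 0) - 0.
    by rewrite mulmx0 scaler0 !subr0 oppr0.
  apply: cvgB => //; apply: cvgB; first by apply: cvgN; exact: dy_cvg.
  by apply: cvgZ; [exact: cvg_cst|apply: cvg_mulmx; exact: dx_cvg].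
- exact/(@cvg_succ _ (fun k => A *m x k - z k))/residual_cvg.
Qed.

Lemma iterates_in_compact : exists2 K : set ('cV[R]_n * 'cV[R]_m * 'cV[R]_m),
  compact K & forall k, K (u k).
Proof.
have [C C0 CP] := components_bounded.
have coord N (v : 'cV[R]_N) : enorm v <= C -> forall i, `|v i 0| <= C.
  move=> vC i; apply: le_trans (coord_le_norm v i) _.
  exact: le_trans (norm_le_ipnorm (@euclidean_dotv R N) v) vC.
pose B N := [set v : 'cV[R]_N | forall i, `|v i 0| <= C].
exists (B n `*` B m `*` B m).
  by apply: compact_setX; [apply: compact_setX|]; exact: cV_box_compact.
by move=> k; have [xC zC yC] := CP k; split; [split|]; apply: coord.
Qed.

Hypothesis g_lsc : lower_semicontinuous g.

Let omega := cluster (u @ \oo).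

Lemma cluster_value p : omega p -> residual A p = 0 /\ Lr p = (limn lag)%:E.
Proof.
move=> /cluster_seq_subsequence[phi phi_gt up].
have phi_ge q : (q <= phi q)%N by exact: ltnW.
by split; [exact: limit_residual phi_ge up|exact: Lr_limit phi_ge up g_lsc].
Qed.

Lemma cluster_sub_crit : omega `<=` crit (@dot3 R n m) Lr.
Proof.
move=> p wp; have [_ Lp] := cluster_value wp.
have [phi phi_gt up] := cluster_seq_subsequence wp.
have predphi_oo : (phi k).-1 @[k --> \oo] --> \oo.
  move=> B [N _ NB]; exists N => // q /= Nq; apply: NB => /=.
  by rewrite -ltnS prednK ?(leq_ltn_trans _ (phi_gt q)).
have phi_oo : phi @ \oo --> \oo.
  move=> B [N _ NB]; exists N => // q /= Nq; apply: NB => /=.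
  by rewrite (leq_trans Nq)// ltnW.
split; first by rewrite Lp ltry.
exists (fun k => u (phi k)), (fun k => D (phi k).-1); split => //.
- exact: (cvg_comp _ _ predphi_oo D_cvg).
- rewrite Lp; exact: (cvg_comp _ _ phi_oo Lr_cvg).
- move=> k; have := D_frechet (phi k).-1.
  by rewrite prednK// (leq_ltn_trans _ (phi_gt k)).
Qed.

Lemma cluster_objective x' : [set p.1.1 | p in omega] x' ->
  (g (A *m x') + (h x')%:E)%E = (limn lag)%:E.
Proof.
move=> [p wp <-]; have [res0 <-] := cluster_value wp.
rewrite /Lr aug_lagrangianE /lag_smooth res0 (ip0r Em) /enorm (ipnorm0 Em).
rewrite expr0n mulr0 !addr0; congr (g _ + _)%E.
by apply/eqP; rewrite -subr_eq0; apply/eqP.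
Qed.

Lemma increment_cvg : u k.+1 - u k @[k --> \oo] -->
  (0 : 'cV[R]_n * 'cV[R]_m * 'cV[R]_m).
Proof. exact: cvg_triple dx_cvg dz_cvg dy_cvg. Qed.

Lemma proximal_admm_limits :
  [/\ forall (phi : nat -> nat) p, increasing_seq phi -> u (phi q) @[q --> \oo] --> p ->
        Lr (u (phi q)) @[q --> \oo] --> Lr p,
      omega `<=` crit (@dot3 R n m) Lr /\
      crit (@dot3 R n m) Lr `<=`
        [set p | [/\ - (A^T *m p.2) = grad h p.1.1,
                     limiting_subdiff (@dotv R m) g p.1.2 p.2 &
                     p.1.2 = A *m p.1.1]],
      dist (@dot3 R n m) (u k) omega @[k --> \oo] --> 0%E,
      [/\ omega !=set0, connected omega & compact omega] &
      exists F : R,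
        [/\ Lr (u k) @[k --> \oo] --> F%:E,
            forall p, omega p -> Lr p = F%:E &
            forall x', [set p.1.1 | p in omega] x' ->
              (g (A *m x') + (h x')%:E)%E = F%:E]].
Proof.
have [K Kco uK] := iterates_in_compact.
split.
- move=> phi p incr up.
  have phi_ge q : (q <= phi q)%N.
    have sincr : {homo phi : a b / (a < b)%N}.
      move=> a b ab; have H : (phi b <= phi a)%N = (b <= a)%N := incr b a.
      by rewrite ltnNge H -ltnNge.
    elim: q => // q ih; exact: leq_ltn_trans ih (sincr _ _ (ltnSn q)).
  rewrite (Lr_limit phi_ge up g_lsc).
  have phi_oo : phi @ \oo --> \oo.
    move=> B [N _ NB]; exists N => // q /= Nq; apply: NB => /=.
    exact: leq_trans Nq (phi_ge q).
  exact: (cvg_comp _ _ phi_oo Lr_cvg).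
- split; first exact: cluster_sub_crit.
  by move=> p /(crit_lagrangian_sub h_diff h_lip g_gtNy).
- exact: (dist_cluster_cvg Kco uK (@euclidean_dot3 R n m)).
- split; first exact: (cluster_seq_nonempty Kco uK).
    exact: (cluster_seq_connected Kco uK increment_cvg).
  exact: (cluster_seq_compact Kco uK).
- exists (limn lag); split; first exact: Lr_cvg.
    by move=> p /cluster_value[].
  exact: cluster_objective.
Qed.

End ADMM.

Theorem lemma11 (R : realType) (n m : nat)
  (g : 'cV[R]_m -> \bar R) (h : 'cV[R]_n -> R) (A : 'M[R]_(m, n)) (L : R)
  (g_gtNy : forall z, (-oo < g z)%E)
  (g_proper : exists z, (g z < +oo)%E)
  (g_lsc : lower_semicontinuous g)
  (h_diff : forall x, differentiable (h : 'cV[R]_n -> R^o) x)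
  (h_lip : forall x x', enorm (grad h x - grad h x') <= L * enorm (x - x'))
  (M1 : nat -> 'M[R]_n) (M2 : nat -> 'M[R]_m)
  (M1_psd : forall k, sym_psd (M1 k)) (M2_psd : forall k, sym_psd (M2 k))
  (alg : algorithm) (r rho : R)
  (hA : assumption_A g h A alg M1 M2 r rho L)
  (x : nat -> 'cV[R]_n) (z y : nat -> 'cV[R]_m)
  (xzy_generated : generated g h A alg M1 M2 r rho x z y)
  (xzy_bounded : exists C : R, forall k, enorm3 (x k, z k, y k) <= C) :
  let u := fun k : nat => (x k, z k, y k) in
  let omega := cluster (u @ \oo) in
  let Lr := aug_lagrangian g h A r in
  [/\ (* (i) *)
      forall (phi : nat -> nat) (p : 'cV[R]_n * 'cV[R]_m * 'cV[R]_m),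
        increasing_seq phi -> u (phi q) @[q --> \oo] --> p ->
        Lr (u (phi q)) @[q --> \oo] --> Lr p,
      (* (ii) *)
      omega `<=` crit (@dot3 R n m) Lr /\
      crit (@dot3 R n m) Lr `<=`
        [set p | [/\ - (A^T *m p.2) = grad h p.1.1,
                     limiting_subdiff (@dotv R m) g p.1.2 p.2 &
                     p.1.2 = A *m p.1.1]],
      (* (iii) *)
      dist (@dot3 R n m) (u k) omega @[k --> \oo] --> 0%E,
      (* (iv) *)
      [/\ omega !=set0, connected omega & compact omega] &
      (* (v) *)
      exists F : R,
        [/\ Lr (u k) @[k --> \oo] --> F%:E,
            forall p, omega p -> Lr p = F%:E &
            forall x', [set p.1.1 | p in omega] x' ->
              (g (A *m x') + (h x')%:E)%E = F%:E]].
Proof.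
exact: (proximal_admm_limits g_gtNy g_proper h_diff h_lip M1_psd M2_psd hA
  xzy_generated xzy_bounded g_lsc).
Qed.
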